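(* There exist finitely generated $\mathrm{BS}$-free groups of cohomological dimension $3$ (over $\mathbb{Z}$) which are not weakly algebraically hyperbolic (weakly AH).
   Context: A group $G$ is weakly algebraically hyperbolic (weakly AH) if it contains no subgroup isomorphic to $\mathbb{Z}^2$ and for every non-trivial $x\in G$ and all $m,n\in\mathbb{Z}$, if $x^m$ and $x^n$ are conjugate in $G$ then $|m|=|n|$. A group is $\mathrm{BS}$-free if it contains no subgroup isomorphic to a Baumslag--Solitar group $\mathrm{BS}(m,n)=\langle a,t\mid t^{-1}a^mt=a^n\rangle$, $m,n\in\mathbb{Z}\smallsetminus\{0\}$. *)

(* Defs.v *)
From HB Require Import structures.
From mathcomp Require Import all_boot all_order all_algebra.
From mathcomp Require Import boolp.

Set Implicit Arguments.
Unset Strict Implicit.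
Unset Printing Implicit Defensive.

Import GRing.Theory.
Local Open Scope group_scope.
Local Open Scope quotient_scope.

Definition expgz (G : groupType) (x : G) (k : int) : G :=
  match k with Posz n => x ^+ n | Negz n => x ^- n.+1 end.

Definition conjugate (G : groupType) (x y : G) := exists g : G, x ^ g = y.

Definition finitely_generated (G : groupType) :=
  exists s : seq G, forall S : {pred G},
    group_closed S -> {subset s <= S} -> forall x : G, x \in S.

(* The subgroups of G isomorphic to H are the images of the injective
   homomorphisms from H to G. *)
Definition contains_copy (G H : groupType) :=
  exists f : {multiplicative H -> G}, injective f.

(* Groups given by a presentation < X | u = v for R u v >.  A letter (x, b)
   stands for the generator x if b is false and for its inverse if b is true. *)
Section Presentation.

Variable X : choiceType.

Definition word := seq (X * bool).

Definition letterV (l : X * bool) : X * bool := (l.1, ~~ l.2).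

Definition wordV (w : word) : word := rev (map letterV w).

Definition word_expz (x : X) (k : int) : word :=
  match k with
  | Posz n => nseq n (x, false)
  | Negz n => nseq n.+1 (x, true)
  end.

Variable R : word -> word -> Prop.

Inductive word_eq : word -> word -> Prop :=
| word_eq_refl w : word_eq w w
| word_eq_sym u v : word_eq u v -> word_eq v u
| word_eq_trans u v w : word_eq u v -> word_eq v w -> word_eq u w
| word_eq_cat u u' v v' :
    word_eq u u' -> word_eq v v' -> word_eq (u ++ v) (u' ++ v')
| word_eq_cancel l : word_eq [:: l; letterV l] [::]
| word_eq_rel u v : R u v -> word_eq u v.

Definition word_eqb (u v : word) : bool := `[< word_eq u v >].

Lemma word_eqb_equiv : equiv_class_of word_eqb.
Proof.
split=> [w|u v|v u w].
- by apply/asboolP; apply: word_eq_refl.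
- by apply/asboolP/asboolP; apply: word_eq_sym.
- by move=> /asboolP uv /asboolP vw; apply/asboolP; apply: word_eq_trans vw.
Qed.

Canonical word_equiv := EquivRelPack word_eqb_equiv.
Canonical word_equiv_direct := defaultEncModRel word_eqb.

Definition presented := {eq_quot word_eqb}.

HB.instance Definition _ := Choice.on presented.

Definition pres_class (w : word) : presented := \pi_presented w.

Lemma pres_classP u v : pres_class u = pres_class v <-> word_eq u v.
Proof.
split=> [/eqmodP/asboolP //|uv].
by apply/eqmodP; apply/asboolP.
Qed.

Definition pres_mul (p q : presented) : presented :=
  pres_class (repr p ++ repr q).
Definition pres_one : presented := pres_class [::].
Definition pres_inv (p : presented) : presented := pres_class (wordV (repr p)).

Lemma pres_reprK (p : presented) : pres_class (repr p) = p.
Proof. exact: reprK. Qed.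

Lemma word_eq_repr w : word_eq (repr (pres_class w)) w.
Proof. by apply/pres_classP; rewrite pres_reprK. Qed.

Lemma word_eqVr w : word_eq (w ++ wordV w) [::].
Proof.
elim: w => [|l w IHw]; first exact: word_eq_refl.
rewrite /wordV map_cons rev_cons -cats1 -/(wordV w).
rewrite -cat1s -catA (catA w).
apply: word_eq_trans (word_eq_cancel l).
rewrite -[X in word_eq _ X]/([:: l] ++ [::] ++ [:: letterV l]).
by do 2?[apply: word_eq_cat]; try exact: word_eq_refl.
Qed.

Lemma wordVK : involutive wordV.
Proof.
move=> w; rewrite /wordV map_rev revK -map_comp map_id_in // => -[x b] _ /=.
by rewrite /letterV /= negbK.
Qed.

Lemma word_eqVl w : word_eq (wordV w ++ w) [::].
Proof. by rewrite -[X in _ ++ X]wordVK; apply: word_eqVr. Qed.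

Lemma pres_mulA : associative pres_mul.
Proof.
move=> p q r; apply/pres_classP.
apply: (@word_eq_trans _ (repr p ++ repr q ++ repr r)).
  by apply: word_eq_cat; [exact: word_eq_refl | exact: word_eq_repr].
rewrite catA; apply: word_eq_sym.
by apply: word_eq_cat; [exact: word_eq_repr | exact: word_eq_refl].
Qed.

Lemma pres_mul1 : left_id pres_one pres_mul.
Proof.
move=> p; rewrite -[RHS]pres_reprK; apply/pres_classP.
rewrite -[X in word_eq _ X]cat0s.
by apply: word_eq_cat; [exact: word_eq_repr | exact: word_eq_refl].
Qed.

Lemma pres_mulr1 : right_id pres_one pres_mul.
Proof.
move=> p; rewrite -[RHS]pres_reprK; apply/pres_classP.
rewrite -[X in word_eq _ X]cats0.
by apply: word_eq_cat; [exact: word_eq_refl | exact: word_eq_repr].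
Qed.

Lemma pres_mulV : left_inverse pres_one pres_inv pres_mul.
Proof.
move=> p; apply/pres_classP; apply: word_eq_trans (word_eqVl (repr p)).
by apply: word_eq_cat; [exact: word_eq_repr | exact: word_eq_refl].
Qed.

Lemma pres_mulrV : right_inverse pres_one pres_inv pres_mul.
Proof.
move=> p; apply/pres_classP; apply: word_eq_trans (word_eqVr (repr p)).
by apply: word_eq_cat; [exact: word_eq_refl | exact: word_eq_repr].
Qed.

HB.instance Definition _ := isGroup.Build presented
  pres_mulA pres_mul1 pres_mulr1 pres_mulV pres_mulrV.

End Presentation.

(* BS(m, n) = < a, t | t^-1 a^m t = a^n >, with a = false and t = true. *)
Section BaumslagSolitar.

Let a := false.
Let t := true.

Inductive BS_rel (m n : int) : word bool -> word bool -> Prop :=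
  BS_relI : BS_rel m n
    (word_expz t (-1) ++ word_expz a m ++ word_expz t 1) (word_expz a n).

End BaumslagSolitar.

Definition BS (m n : int) : groupType := presented (BS_rel m n).

Definition BS_free (G : groupType) :=
  forall m n : int, m <> 0%R -> n <> 0%R -> ~ contains_copy G (BS m n).

Definition Z2 : groupType := Algebra.to_multiplicative (int * int)%type.

Definition weakly_AH (G : groupType) :=
  ~ contains_copy G Z2 /\
  forall x : G, x <> 1 -> forall m n : int,
    conjugate (expgz x m) (expgz x n) -> `|m|%N = `|n|%N.

(* Left ZG-modules, as abelian groups with a linear action of G. *)
Record gmodule (G : groupType) := GModule {
  gmod_car :> zmodType;
  gact : G -> {additive gmod_car -> gmod_car};
  gact1 : forall x, gact 1 x = x;
  gactM : forall g h x, gact (g * h) x = gact g (gact h x)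
}.

Arguments gact {G _} g.

Record gmod_hom (G : groupType) (M N : gmodule G) := GModHom {
  gmod_fun :> {additive M -> N};
  gmod_funJ : forall (g : G) (x : M), gmod_fun (gact g x) = gact g (gmod_fun x)
}.

Definition gmod_trivialZ (G : groupType) : gmodule G :=
  @GModule G int (fun _ => idfun) (fun _ => erefl) (fun _ _ _ => erefl).

Definition surjective (A B : Type) (f : A -> B) := forall y, exists x, f x = y.

Definition projective (G : groupType) (P : gmodule G) :=
  forall (M N : gmodule G) (p : gmod_hom M N) (f : gmod_hom P N),
    surjective p -> exists h : gmod_hom P M, forall x, p (h x) = f x.

Definition exact_at (G : groupType) (L M N : gmodule G)
    (f : gmod_hom L M) (g : gmod_hom M N) :=
  forall y : M, g y = 0%R <-> exists x : L, f x = y.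

(* There is a projective resolution 0 -> P_n -> ... -> P_0 -> Z -> 0 of the
   trivial ZG-module Z. *)
Definition cd_le (G : groupType) (n : nat) :=
  exists (P : nat -> gmodule G) (d : forall i, gmod_hom (P i.+1) (P i))
         (e : gmod_hom (P 0) (gmod_trivialZ G)),
    [/\ forall i, projective (P i),
        forall i, n < i -> forall x : P i, x = 0%R,
        surjective e,
        exact_at (d 0) e
      & forall i, exact_at (d i.+1) (d i)].

Definition cohomological_dimension (G : groupType) (n : nat) :=
  cd_le G n /\ forall m, cd_le G m -> n <= m.

(* Main.v *)
Require Import Defs.
From HB Require Import structures.
From mathcomp Require Import all_boot all_order all_algebra.
From mathcomp Require Import finmap.
From mathcomp Require Import boolp.
From mathcomp Require Import monalg.
From mathcomp Require Import zify ring lra.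

(** The witness is the group [aff] of the affine maps x |-> (3/2)^k x + v of the
    line, with k an integer and v in Z[1/6]; it is the extension of Z[1/6] by
    the multiplication by 3/2.  It is generated by the translation by 1 and the
    dilation t = 3/2, because 1/6 = 3/2 - 2/3 - 2/3 ([aff_fg]), and t conjugates
    the square of that translation to its cube, so it is not weakly AH.

    It is BS-free ([aff_BS_free]): let a and t satisfy t^-1 a^m t = a^n.  If
    m = n, then a power of a commutes with t, which confines a and t to the group
    of translations or to the stabilizer of a point, both of rank one; but
    BS(m, m) maps onto Z^2 ([aff_rank_one], [BS_diag_free]).  If m <> n, then a is
    a translation and n / m is a nontrivial power of 3/2, so that |m|, |n| > 1.
    As translations commute, so do a and t^-1 a t, which is false in BS(m, n):
    an explicit action tells the two products apart ([BS_noncomm]).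

    The cohomological dimension is at most 3 ([aff_cd_le3]).  Let a_i be the
    translation by 6^-i, and F the free module with basis (e_i), i in nat, so that
    F is the group of chains on the set nat * aff.  Dividing that set successively
    by (i, g) ~ (i, g a_i), (i, g) ~ (i+1, g) and (i, g) ~ (i+1, g t) leaves the
    cosets of the groups generated by the a_i, then the cosets of Z[1/6], then a
    point.  In each quotient the next of these moves is a map without
    periodic points, hence it fixes no chain but zero ([push_fixed]).  Thus the
    endomorphisms A, B, C of F given by the moves minus the identity behave like
    a regular sequence, and a Koszul complex 0 -> F -> F^3 -> F^3 -> F resolves Z
    ([koszul_exactS]).  The moves commute only up to norm elements, which is why
    its last map involves B' and C' as well.

    The dimension is at least 3 ([aff_cd_ge3]).  A shorter resolution would split
    the map F -> F^3 ([boundary_retraction]).  On the basis, a splitting amounts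
    to elements x_i, y_i, z_i of F with
      (t N_4(a_{i+1}) x_{i+1} - x_i) - (N_6(a_{i+1}) y_{i+1} - y_i)
        + (a_i - 1) z_i = e_i,   where N_k(a) = 1 + a + ... + a^{k-1}.
    For every J there are additive functionals L_i on F, supported on the J-th
    summand, such that L_i is invariant under a_i and both
    L_i(N_6(a_{i+1}) w) and L_i(t N_4(a_{i+1}) w) equal L_{i+1}(w), with
    L_J(e_J) = 1 and L_{J+1} = 0.  Applying L_i and summing over i <= J telescopes
    to L_0(y_0 - x_0) = 1, absurd when J is beyond the supports of x_0 and y_0.
    The functionals come from a measure on the product of the fields of 2-adic and
    3-adic numbers, (delta_0 - delta_u) x (delta_0 - delta_v) with u = 2^{-J-1}
    and v = 3^{-J-1}: its first factor kills the functions invariant under u, and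
    its second one those invariant under v.  Multiplication by (3/2)^k does not
    enlarge u if k <= 0, nor v if k >= 0, whence L_{J+1} = 0 ([weight_last]). *)

Set Implicit Arguments.
Unset Strict Implicit.
Unset Printing Implicit Defensive.

Import Order.TTheory GRing.Theory Num.Theory.
Local Open Scope ring_scope.

(** * Chains on a set *)

Definition additive_of (M N : zmodType) (f : M -> N)
    (fB : {morph f : x y / x - y}) : {additive M -> N} :=
  HB.pack f (GRing.isZmodMorphism.Build M N f fB).

Definition chain (X : choiceType) : Type := @malg X int.
HB.instance Definition _ (X : choiceType) := GRing.Zmodule.on (chain X).

(** Locked, as unifying two distinct cells would unfold finitely supported
    functions. *)
HB.lock Definition cell (X : choiceType) (x : X) : chain X := << 1 *g x >>.
Arguments cell {X} x.

Section FreeAbelian.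
Variable X : choiceType.
Implicit Types (x : X) (z : chain X).

Lemma chain_ind (S : chain X -> Prop) :
  S 0 -> (forall z w, S z -> S w -> S (z - w)) -> (forall x, S (cell x)) ->
  forall z, S z.
Proof.
move=> S0 SB Sx z.
have SN w : S w -> S (- w) by rewrite -[- w]add0r; apply: SB.
have SD w w' : S w -> S w' -> S (w + w').
  by move=> Sw /SN; rewrite -{2}[w']opprK; apply: SB.
rewrite [z]monalgE; apply: (big_ind S) => // x _.
have SxM n : S (<< 1 *g x >> *+ n).
    have := Sx x; rewrite unlock => {}Sx.
  by elim: n => [|n IHn]; rewrite ?mulr0n // mulrS; apply: SD.
case: (mcoeff _ _) => n; last rewrite NegzE monalgUN.
  by rewrite -natz monalgUMn; apply: SxM.
by rewrite -natz monalgUMn; apply/SN/SxM.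
Qed.

Variable M : zmodType.

Section Lift.
Variable f : X -> M.

Definition lift_fun z : M := \sum_(x <- msupp z) f x *~ mcoeff x z.

Lemma lift_funEw (D : {fset X}) z : (msupp z `<=` D)%fset ->
  lift_fun z = \sum_(x <- D) f x *~ mcoeff x z.
Proof.
move=> zD; rewrite /lift_fun (big_fset_incl _ zD) // => x _ /mcoeff_outdom ->.
by rewrite mulr0z.
Qed.

Lemma lift_funB : {morph lift_fun : z w / z - w}.
Proof.
move=> z w; set D := (msupp z `|` msupp w)%fset.
rewrite (@lift_funEw D) ?msuppB_le // (@lift_funEw D z) ?fsubsetUl //.
rewrite (@lift_funEw D w) ?fsubsetUr // -sumrB; apply: eq_bigr => x _.
by rewrite mcoeffB mulrzBr.
Qed.

Definition chain_lift : {additive chain X -> M} := additive_of lift_funB.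

Lemma lift_cell x : chain_lift (cell x) = f x.
Proof.
by rewrite unlock /= (@lift_funEw [fset x]%fset) ?msuppU_le // big_seq_fset1 mcoeffUU.
Qed.
End Lift.

Lemma chain_ext (f g : {additive chain X -> M}) :
  (forall x, f (cell x) = g (cell x)) -> f =1 g.
Proof.
move=> fg; apply: chain_ind => [|z w fz fw|//]; first by rewrite !raddf0.
by rewrite !raddfB fz fw.
Qed.

End FreeAbelian.
Arguments chain_lift : simpl never.

Section Push.
Variables X Y : choiceType.

Definition push (q : X -> Y) : {additive chain X -> chain Y} :=
  chain_lift (fun x => cell (q x)).

Lemma push_cell q x : push q (cell x) = cell (q x). Proof. exact: lift_cell. Qed.

(** Choosing a preimage of each point of the image of [q] gives a map [s] from the
    chains of [Y] to those of [X] such that [z - s (push q z)] lies in [S] for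
    every [z], since this holds for cells. *)
Lemma ker_push (q : X -> Y) (S : chain X -> Prop) :
    S 0 -> (forall z w, S z -> S w -> S (z - w)) ->
    (forall x y, q x = q y -> S (cell x - cell y)) ->
  forall z, push q z = 0 -> S z.
Proof.
move=> S0 SB Sq z qz0.
have /choice[s sP] (y : Y) : exists c : chain X,
    (exists x, q x = y) -> exists2 x, q x = y & c = cell x.
  have [[x qx]|nx] := pselect (exists x, q x = y); last by exists 0.
  by exists (cell x) => _; exists x.
suff Sz : S (z - chain_lift s (push q z)) by rewrite qz0 raddf0 subr0 in Sz.
move: z {qz0}; apply: chain_ind => [|z w Sz Sw|x].
- by rewrite !raddf0 addr0.
- suff -> : z - w - chain_lift s (push q (z - w)) =
    (z - chain_lift s (push q z)) - (w - chain_lift s (push q w)) by apply: SB.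
  by rewrite (raddfB (push q)) (raddfB (chain_lift s)) !opprD !opprK addrACA.
- rewrite push_cell lift_cell.
  by have [|x' qx' ->] := sP (q x); [exists x | apply: Sq].
Qed.
End Push.
Arguments push : simpl never.

Lemma push_comp (X Y Z : choiceType) (f : X -> Y) (g : Y -> Z) z :
  push g (push f z) = push (g \o f) z.
Proof.
move: z; apply: (chain_ext (f := push g \o push f)) => x.
by rewrite -[LHS]/(push g (push f (cell x))) !push_cell.
Qed.

Lemma eq_push (X Y : choiceType) (f g : X -> Y) : f =1 g -> push f =1 push g.
Proof. by move=> fg; apply: chain_ext => x; rewrite !push_cell fg. Qed.

(** A finitely supported chain fixed by [phi] has a support permuted by [phi], so
    a map without periodic points fixes only the zero chain. *)
Lemma push_fixed (X : choiceType) (phi : X -> X) :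
    (forall x n, iter n.+1 phi x <> x) ->
  forall z, push phi z = z -> z = 0.
Proof.
move=> aper z phiz; set D := msupp z.
have subD : (D `<=` [fset phi x | x in D])%fset.
  apply/fsubsetP => y; rewrite -mcoeff_neq0 -phiz.
  rewrite [push _ _]/(lift_fun _ _) raddf_sum /=.
  apply: contraR => yD; rewrite big1_seq // => x /andP[_ xD].
  rewrite raddfMz unlock /= mcoeffU; case: eqP => [phix|_]; last by rewrite mul0rz.
  by case/imfsetP: yD; exists x.
have phiD x : x \in D -> phi x \in D.
  have /eqP {2}-> : D == [fset phi x | x in D]%fset.
    by rewrite eqEfcard subD; apply: leq_imfset_card.
  by move=> xD; apply/imfsetP; exists x.
apply/malgP => x; rewrite mcoeff0; apply: contrapT => /eqP.
rewrite mcoeff_neq0 -/D => xD.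
have : ~~ uniq (traject phi x #|` D|.+1).
  apply/negP => uniq_phi.
  suff /(uniq_leq_size uniq_phi) : {subset traject phi x #|` D|.+1 <= D}.
    by rewrite size_traject ltnn.
  by move=> y /trajectP[i _ ->]; elim: i => //= i; apply: phiD.
rewrite looping_uniq negbK => /trajectP[i ltiD].
by rewrite -{1}(subnK ltiD) -addSnnS iterD => /aper.
Qed.

Arguments gmod_fun {G M N} f : rename.
Arguments gact {G _} g : rename.

(** * Modules over a group *)

Section Modules.
Variable G : groupType.
Implicit Types L M N P : gmodule G.

Definition gmod_zero : gmodule G.
Proof.
by exists (chain void) (fun _ => idfun).
Defined.

Lemma gmod_zeroE (x : gmod_zero) : x = 0.
Proof. by move: x; apply: chain_ind => // x y -> ->; rewrite subr0. Qed.

Lemma pair_actB M N (g : G) :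
  {morph (fun x : M * N => (gact g x.1, gact g x.2) : (M * N)%type) : x y / x - y}.
Proof. by move=> x y /=; rewrite !raddfB. Qed.

Definition gmod_prod M N : gmodule G.
Proof.
exists (M * N)%type (fun g => additive_of (@pair_actB M N g)) => [[x y]|g h [x y]] /=.
  by rewrite !gact1.
by rewrite !gactM.
Defined.

Definition hom_of M N (f : M -> N) (fB : {morph f : x y / x - y})
    (fJ : forall g x, f (gact g x) = gact g (f x)) : gmod_hom M N :=
  @GModHom G M N (additive_of fB) fJ.

Definition hom_comp L M N (f : gmod_hom M N) (h : gmod_hom L M) : gmod_hom L N.
Proof.
by apply: (@hom_of L N (f \o h)) => [x y|g x] /=; rewrite ?raddfB // !gmod_funJ.
Defined.

Lemma hom_compE L M N (f : gmod_hom M N) (h : gmod_hom L M) x :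
  hom_comp f h x = f (h x).
Proof. by []. Qed.

Definition hom_sub M N (f h : gmod_hom M N) : gmod_hom M N.
Proof.
apply: (@hom_of M N (fun x => f x - h x)) => [x y|g x] /=.
  by rewrite (raddfB f) (raddfB h) !opprD !opprK addrACA.
by rewrite !gmod_funJ raddfB.
Defined.

Definition hom_zero M N : gmod_hom M N.
Proof.
by apply: (@hom_of M N (fun=> 0)) => [x y|g x]; rewrite ?subr0 ?raddf0.
Defined.

Definition hom_id M : gmod_hom M M.
Proof. by apply: (@hom_of M M id). Defined.

(** The image of [d], as a module: a map out of a projective module that takes
    its values in this image lifts along [d]. *)
Section Image.
Variables (L M : gmodule G) (d : gmod_hom L M).

Definition image_pred : {pred M} := [pred m | `[< exists l, d l = m >]].

Lemma image_zmod_closed : zmod_closed image_pred.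
Proof.
split; first by apply/asboolP; exists 0; rewrite raddf0.
move=> x y /asboolP[l <-] /asboolP[l' <-]; apply/asboolP.
by exists (l - l'); rewrite raddfB.
Qed.

HB.instance Definition _ := GRing.isZmodClosed.Build M image_pred image_zmod_closed.

Record image_type := Image { image_val :> M; _ : image_pred image_val }.
HB.instance Definition _ := [isSub for image_val].
HB.instance Definition _ := [Choice of image_type by <:].
HB.instance Definition _ := [SubChoice_isSubZmodule of image_type by <:].

Lemma image_act_subproof (g : G) (x : image_type) : image_pred (gact g (val x)).
Proof.
case: x => x /= /asboolP[l <-]; apply/asboolP.
by exists (gact g l); rewrite gmod_funJ.
Qed.

Definition image_act (g : G) (x : image_type) := Image (image_act_subproof g x).

Lemma image_actB g : {morph image_act g : x y / x - y}.
Proof. by move=> x y; apply: val_inj; rewrite /= !raddfB. Qed.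

Definition gmod_image : gmodule G.
Proof.
exists image_type (fun g => additive_of (image_actB g)) => [x|g h x];
  apply: val_inj => /=; [exact: gact1 | exact: gactM].
Defined.

End Image.

Section ToImage.
Variables (L M N : gmodule G) (d : gmod_hom L M) (f : gmod_hom N M).
Hypothesis fd : forall x, exists l, d l = f x.

Lemma to_image_subproof x : image_pred d (f x).
Proof. exact/asboolP. Qed.

Definition to_image : gmod_hom N (gmod_image d).
Proof.
apply: (@hom_of N (gmod_image d) (fun x => Image (to_image_subproof x)))
    => [x y|g x]; apply: val_inj; rewrite /= ?raddfB //.
by rewrite gmod_funJ.
Defined.

End ToImage.

Lemma projective_lift P L M (d : gmod_hom L M) (f : gmod_hom P M) :
    projective P -> (forall x, exists l, d l = f x) ->
  exists h : gmod_hom P L, forall x, d (h x) = f x.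
Proof.
move=> projP fd.
have dd x : exists l, d l = d x by exists x.
have [|h hP] := projP _ _ (to_image dd) (to_image fd).
  case=> m /[dup] /asboolP[l dl] mP; exists l.
  by apply: (@val_inj _ _ (image_type d)); apply: dl.
by exists h => x; have /(congr1 val) := hP x.
Qed.

Definition hom_inl M N : gmod_hom M (gmod_prod M N).
Proof.
apply: (@hom_of M (gmod_prod M N) (fun x => (x, 0))) => [x y|g x] /=.
  by congr pair; rewrite subr0.
by rewrite raddf0.
Defined.

Definition hom_inr M N : gmod_hom N (gmod_prod M N).
Proof.
apply: (@hom_of N (gmod_prod M N) (fun x => (0, x))) => [x y|g x] /=.
  by congr pair; rewrite subr0.
by rewrite raddf0.
Defined.

Definition hom_copair L M N (h : gmod_hom M L) (k : gmod_hom N L) :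
  gmod_hom (gmod_prod M N) L.
Proof.
apply: (@hom_of (gmod_prod M N) L (fun x => h x.1 + k x.2)) => [x y|g x] /=.
  by rewrite (raddfB h) (raddfB k) addrACA opprD.
by rewrite !gmod_funJ raddfD.
Defined.

Lemma projective_prod M N :
  projective M -> projective N -> projective (gmod_prod M N).
Proof.
move=> projM projN A B p f surjp.
have [h hP] := projM _ _ _ (hom_comp f (hom_inl M N)) surjp.
have [k kP] := projN _ _ _ (hom_comp f (hom_inr M N)) surjp.
exists (hom_copair h k) => -[x y]; rewrite /= raddfD hP kP /= -raddfD.
by congr (f _); congr pair; rewrite /= ?addr0 ?add0r.
Qed.

Lemma projective_zero : projective gmod_zero.
Proof.
move=> M N p f _; exists (hom_zero _ _) => x /=.
by rewrite [x]gmod_zeroE !raddf0.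
Qed.

Section Free.

Definition cellJ (g : G) (x : nat * G) := (x.1, (g * x.2)%g).

(** The free module of countable rank, as the chains on the free action of [G] on
    [nat * G]; [gcell i 1] is the [i]-th vector of its basis. *)
Definition gmod_free : gmodule G.
Proof.
exists (chain (nat * G)%type) (fun g => push (cellJ g)) => [|g h] z.
  move: z; apply: (chain_ext (g := idfun)) => -[i g].
  by rewrite push_cell /cellJ mul1g.
by rewrite push_comp; apply: eq_push => -[i k]; rewrite /cellJ /= mulgA.
Defined.

Definition gcell (i : nat) (g : G) : gmod_free := cell (i, g).

Lemma gact_gcell (g h : G) i : gact g (gcell i h) = gcell i (g * h)%g.
Proof. exact: push_cell. Qed.

Lemma additive_ext (A : zmodType) (f h : {additive gmod_free -> A}) :
  (forall i g, f (gcell i g) = h (gcell i g)) -> f =1 h.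
Proof. by move=> fh; apply: (@chain_ext _ _ f h) => -[i g]; apply: fh. Qed.

Lemma lift_gcell (A : zmodType) (f : nat * G -> A) i g : chain_lift f (gcell i g) = f (i, g).
Proof. exact: lift_cell. Qed.

Lemma push_gcell (X : choiceType) (f : nat * G -> X) i g :
  push f (gcell i g) = cell (f (i, g)).
Proof. exact: push_cell. Qed.

Lemma free_act M (m : nat -> M) (g : G) (z : gmod_free) :
  chain_lift (fun x : nat * G => gact x.2 (m x.1)) (gact g z) =
  gact g (chain_lift (fun x : nat * G => gact x.2 (m x.1)) z).
Proof.
pose f := chain_lift (fun x : nat * G => gact x.2 (m x.1)).
move: z; apply: (@chain_ext _ _ (f \o push (cellJ g)) (gact g \o f)) => -[i h].
rewrite -[LHS]/(f (push _ (cell (i, h)))) -[RHS]/(gact g (f _)) push_cell.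
by rewrite /f !lift_cell gactM.
Qed.

Definition free_hom M (m : nat -> M) : gmod_hom gmod_free M :=
  GModHom (free_act m).

Lemma free_homE M (m : nat -> M) i (g : G) :
  free_hom m (gcell i g) = gact g (m i).
Proof. exact: lift_cell. Qed.

Lemma free_ext M (f h : gmod_hom gmod_free M) :
  (forall i, f (gcell i 1%g) = h (gcell i 1%g)) -> f =1 h.
Proof.
move=> fh; apply: (@chain_ext _ _ f h) => -[i g].
by rewrite -[cell _]/(gcell i g) -[g]mulg1 -gact_gcell !gmod_funJ fh.
Qed.

Lemma projective_free : projective gmod_free.
Proof.
move=> M N p f surjp.
have /choice[m mP] i : exists x, p x = f (gcell i 1%g) by apply: surjp.
exists (free_hom m).
apply: (@free_ext _ (hom_comp p (free_hom m)) f) => i.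
by rewrite -[LHS]/(p (free_hom m (gcell i 1%g))) free_homE gact1 mP.
Qed.

End Free.

End Modules.

(** * Comparison of resolutions *)
Section Comparison.
Variable G : groupType.

Definition cycle (P : nat -> gmodule G)
    (d : forall i, gmod_hom (P i.+1) (P i))
    (e : gmod_hom (P 0) (gmod_trivialZ G)) i : P i -> Prop :=
  match i with
  | 0 => fun x => e x = 0
  | j.+1 => fun x => d j x = 0
  end.

Variables (P Q : nat -> gmodule G).
Variables (d : forall i, gmod_hom (P i.+1) (P i))
          (e : gmod_hom (P 0) (gmod_trivialZ G)).
Variables (d' : forall i, gmod_hom (Q i.+1) (Q i))
          (e' : gmod_hom (Q 0) (gmod_trivialZ G)).
Hypotheses (projP : forall i, projective (P i))
           (projQ : forall i, projective (Q i)).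
Hypotheses (surje : surjective e) (surje' : surjective e').
Hypotheses (exact0 : exact_at (d 0) e) (exactS : forall i, exact_at (d i.+1) (d i)).
Hypotheses (exact0' : exact_at (d' 0) e')
           (exactS' : forall i, exact_at (d' i.+1) (d' i)).

Lemma cycleP i (x : P i) : cycle d e x <-> exists y, d i y = x.
Proof. by case: i x => [|i] x; [apply: exact0 | apply: exactS]. Qed.

Lemma cycleP' i (x : Q i) : cycle d' e' x <-> exists y, d' i y = x.
Proof. by case: i x => [|i] x; [apply: exact0' | apply: exactS']. Qed.

(** The comparison maps [P -> Q -> P] are homotopic to the identity.  Stated on
    cycles, the homotopy in degree [i] involves neither its predecessor nor the
    maps in lower degrees, so the induction carries data of a single degree. *)
Lemma comparison_on_cycles i :
  exists (f : gmod_hom (P i) (Q i)) (g : gmod_hom (Q i) (P i))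
         (h : gmod_hom (P i) (P i.+1)),
    [/\ forall x, cycle d e x -> cycle d' e' (f x),
        forall y, cycle d' e' y -> cycle d e (g y)
      & forall x, cycle d e x -> d i (h x) = x - g (f x)].
Proof.
elim: i => [|i [f [g [h [fP gP hP]]]]].
  have [f fP] := projective_lift (d := e') (f := e) (@projP 0) (fun x => surje' (e x)).
  have [g gP] := projective_lift (d := e) (f := e') (@projQ 0) (fun x => surje (e' x)).
  have [|h hP] := projective_lift (d := d 0)
      (f := hom_sub (hom_id (P 0)) (hom_comp g f)) (@projP 0).
    move=> x; apply/exact0; apply/eqP.
    by rewrite [e _](raddfB e) /= gP fP subr_eq0.
  by exists f, g, h; split => [x|y|x _]; rewrite /= ?fP ?gP.
have [|f' fP'] := projective_lift (d := d' i) (f := hom_comp f (d i)) (@projP i.+1).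
  by move=> x; apply/cycleP'/fP/cycleP; exists x.
have [|g' gP'] := projective_lift (d := d i) (f := hom_comp g (d' i)) (@projQ i.+1).
  by move=> x; apply/cycleP/gP/cycleP'; exists x.
have [|h' hP'] := projective_lift (d := d i.+1)
    (f := hom_sub (hom_sub (hom_id (P i.+1)) (hom_comp g' f')) (hom_comp h (d i)))
    (@projP i.+1).
  move=> x; apply/exactS; apply/eqP.
  rewrite [d i _](raddfB (d i)) [d i _](raddfB (d i)) /= gP' /= fP' /=.
  have -> : d i (h (d i x)) = d i x - g (f (d i x)) by apply/hP/cycleP; exists x.
  by rewrite subrr.
exists f', g', h'; split => [x dx|y dy|x dx] /=.
- by rewrite fP' /= dx raddf0.
- by rewrite gP' /= dy raddf0.
- by rewrite hP' /= dx raddf0 subr0.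
Qed.

(** If [Q] vanishes above degree [n], then so do the cycles of [Q] in degree [n],
    and the homotopy is a right inverse of [d n] on the cycles of [P], hence a left
    inverse of [d n] when that map is injective. *)
Lemma boundary_retraction n :
    (forall y : Q n.+1, y = 0) -> injective (d n) ->
  exists h : gmod_hom (P n) (P n.+1), forall y, h (d n y) = y.
Proof.
move=> Q0 injd; have [f [g [h [fP gP hP]]]] := comparison_on_cycles n.
exists h => y; apply: injd.
have cdy : cycle d e (d n y) by apply/cycleP; exists y.
rewrite hP //; have /cycleP'[z <-] := fP _ cdy.
by rewrite [z]Q0 (raddf0 (d' n)) (raddf0 g) subr0.
Qed.

End Comparison.

(** * A Koszul complex on three endomorphisms *)
Section Koszul.
Variables (G : groupType) (F : gmodule G).
Variables (A B C B' C' : gmod_hom F F) (e : gmod_hom F (gmod_trivialZ G)).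

Hypothesis projF : projective F.
Hypothesis BA : forall x, B (A x) = A (B' x).
Hypothesis CA : forall x, C (A x) = A (C' x).
Hypothesis CB : forall x, C (B x) = B (C x).
Hypothesis C'B' : forall x, C' (B' x) = B' (C' x).
Hypothesis A_inj : forall x, A x = 0 -> x = 0.
Hypothesis B_reg : forall x y, B x = A y -> exists y', x = A y'.
Hypothesis C_reg : forall x y z, C x = A y + B z -> exists y' z', x = A y' + B z'.
Hypothesis surje : surjective e.
Hypothesis eP : forall x, e x = 0 <-> exists u v w, x = A u + B v + C w.

(** The hypotheses say that [A] is injective, [B] is injective modulo the image of
    [A], and [C] modulo those of [A] and [B].  As [B] and [C] commute with [A] only
    up to replacing them with [B'] and [C'], they are so replaced in the copies of
    [F] reached through [A]. *)
Let F3 := gmod_prod F (gmod_prod F F).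

Definition koszul1 : gmod_hom F3 F.
Proof.
apply: (@hom_of _ F3 F (fun x => A x.1 + B x.2.1 + C x.2.2)) => [x y|g x] /=.
  rewrite (raddfB A) (raddfB B) (raddfB C) !opprD.
  by rewrite [X in X + _]addrACA [LHS]addrACA.
by rewrite !gmod_funJ !raddfD.
Defined.

Definition koszul2 : gmod_hom F3 F3.
Proof.
apply: (@hom_of _ F3 F3 (fun x =>
  (- B' x.1 - C' x.2.1, (A x.1 - C x.2.2, A x.2.1 + B x.2.2)))) => [x y|g x] /=.
  rewrite (raddfB A) (raddfB A) (raddfB B) (raddfB C) (raddfB B') (raddfB C').
  by congr (_, (_, _)); rewrite /= !opprD ?opprK addrACA.
by rewrite !gmod_funJ !raddfD !raddfN.
Defined.

Definition koszul3 : gmod_hom F F3.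
Proof.
apply: (@hom_of _ F F3 (fun x => (C' x, (- B' x, A x)))) => [x y|g x] /=.
  rewrite (raddfB A) (raddfB B') (raddfB C').
  by congr (_, (_, _)); rewrite /= opprD.
by rewrite !gmod_funJ raddfN.
Defined.

Definition koszul (i : nat) : gmodule G :=
  match i with 0 | 3 => F | 1 | 2 => F3 | _ => gmod_zero G end.

Definition koszul_d (i : nat) : gmod_hom (koszul i.+1) (koszul i) :=
  match i with
  | 0 => koszul1 | 1 => koszul2 | 2 => koszul3 | _ => hom_zero _ _
  end.

Lemma projective_koszul i : projective (koszul i).
Proof.
have projF3 : projective F3 by do 2!apply: projective_prod => //.
by case: i => [|[|[|[|i]]]] //=; apply: projective_zero.
Qed.

Lemma koszul_exact0 : exact_at (koszul_d 0) e.
Proof.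
move=> x; rewrite eP; split=> [[u [v [w ->]]]|[[u [v w]] /= <-]].
  by exists (u, (v, w)).
by exists u, v, w.
Qed.

Lemma koszul_exactS i : exact_at (koszul_d i.+1) (koszul_d i).
Proof.
case: i => [|[|[|i]]] /=; last first.
- move=> x; split=> // _; exists 0; first by rewrite [x]gmod_zeroE raddf0.
- move=> x; split=> [[_ _ /A_inj ->]|[y <-]]; first by exists 0; rewrite raddf0.
  by rewrite !raddf0.
- move=> [y [z w]]; split=> [[_] /= E2 E3|[x [<- <- <-]]] /=; last first.
    congr (_, (_, _)); rewrite ?raddfN.
    + by rewrite opprK C'B' addrC subrr.
    + by rewrite CA subrr.
    + by rewrite BA addrC subrr.
  have [|x wx] := B_reg (x := w) (y := - z).
    by rewrite raddfN; apply/eqP; rewrite -addr_eq0 addrC E3.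
  exists x; rewrite -wx; congr (_, (_, _)).
    apply/eqP; rewrite -subr_eq0; apply/eqP/A_inj; rewrite raddfB -CA -wx.
    by apply/eqP; rewrite -opprB oppr_eq0; apply/eqP.
  apply/eqP; rewrite -subr_eq0; apply/eqP/A_inj; rewrite raddfB raddfN -BA -wx.
  by apply/eqP; rewrite -opprD oppr_eq0 addrC; apply/eqP.
- move=> [u [v w]]; split=> /= [E|[[y [z w']] [<- <- <-]]]; last first.
    rewrite (raddfB A) (raddfN A) (raddfB B) (raddfD C) -BA -CA CB.
    by rewrite -addrA [X in _ + X]addrACA addNr addr0 -opprD addNr.
  have [|z [w' wE]] := C_reg (x := w) (y := - u) (z := - v).
    by rewrite !raddfN; apply/eqP; rewrite -opprD -addr_eq0 addrC E.
  have E' : B (v + C w') = A (- (u + C' z)).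
    rewrite raddfN; apply/eqP; rewrite -addr_eq0 (raddfD B) (raddfD A) -CA -CB.
    by rewrite addrACA -(raddfD C) [_ + A z]addrC -wE [B v + _]addrC E.
  have [y yE] := B_reg E'.
  exists (y, (z, w')); rewrite /= -wE -yE addrK; congr (_, _).
  apply/eqP; rewrite -subr_eq0; apply/eqP/A_inj.
  have := E'; rewrite yE BA => /eqP; rewrite -subr_eq0 -raddfB opprK => /eqP E2.
  rewrite -[RHS]oppr0 -E2 -[RHS]raddfN; congr (A _).
  by rewrite !opprD [- u - _]addrC addrA.
Qed.

Lemma koszul_cd_le : cd_le G 3.
Proof.
exists koszul, koszul_d, e; split=> //.
- exact: projective_koszul.
- by move=> [|[|[|[|i]]]] //= _ x; apply: gmod_zeroE.
- exact: koszul_exact0.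
- exact: koszul_exactS.
Qed.

Lemma koszul_retraction m : cd_le G m -> (m < 3)%N ->
  exists r1 r2 r3 : gmod_hom F F,
    forall x, r1 (C' x) - r2 (B' x) + r3 (A x) = x.
Proof.
move=> [Q [d' [e' [projQ Q0 surje' ex0' exS']]]] ltm3.
have [||h hP] := boundary_retraction projective_koszul projQ surje surje'
  koszul_exact0 koszul_exactS ex0' exS' (n := 2).
- exact: Q0.
- move=> x y /= [_ _ /eqP]; rewrite -subr_eq0 -raddfB => /eqP/A_inj/eqP.
  by rewrite subr_eq0 => /eqP.
exists (hom_comp h (hom_inl F _)), (hom_comp h (hom_comp (hom_inr F _) (hom_inl F F))),
  (hom_comp h (hom_comp (hom_inr F _) (hom_inr F F))) => x /=.
rewrite -[RHS]hP -raddfB -raddfD; congr (h _) => /=.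
by congr (_, (_, _)); rewrite /= ?subr0 ?addr0 ?sub0r ?add0r ?addr0 // oppr0.
Qed.

End Koszul.

(** * The affine group over Z[1/6] with ratio 3/2 *)

(** Locked, lest unification compute with rational constants. *)
HB.lock Definition q : rat := 3%:R / 2%:R.

(** The subring Z[1/6] of the rational numbers. *)
Definition inv6 : {pred rat} := 
  [pred x : rat | `[< exists n : nat, (x * 6%:R ^+ n : rat) \is a Num.int >]].

Lemma inv6P x : reflect (exists n : nat, x * 6%:R ^+ n \is a Num.int) (x \in inv6).
Proof. exact: asboolP. Qed.

Lemma inv6_le (x : rat) n m : (n <= m)%N ->
  x * 6%:R ^+ n \is a Num.int -> x * 6%:R ^+ m \is a Num.int.
Proof.
move=> /subnK <- xn; rewrite addnC exprD mulrA.
by rewrite rpredM // rpredX // rpred_nat.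
Qed.

Lemma inv6_subring_closed : subring_closed inv6.
Proof.
split; first by apply/inv6P; exists 0%N; rewrite expr0 mulr1.
  move=> x y /inv6P[n xn] /inv6P[m ym]; apply/inv6P; exists (maxn n m).
  by rewrite mulrBl rpredB //; [apply: inv6_le xn | apply: inv6_le ym];
    rewrite ?leq_maxl ?leq_maxr.
move=> x y /inv6P[n xn] /inv6P[m ym]; apply/inv6P; exists (n + m)%N.
by rewrite exprD mulrACA rpredM.
Qed.

HB.instance Definition _ := GRing.isSubringClosed.Build rat inv6 inv6_subring_closed.

Lemma inv6V (n : nat) : (6%:R ^+ n)^-1 \in inv6.
Proof. by apply/inv6P; exists n; rewrite mulVf ?expf_neq0 // rpred1. Qed.

Lemma qE : q = 3%:R / 2%:R. Proof. by rewrite unlock. Qed.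
Lemma q_neq0 (k : int) : q ^ k != 0. Proof. by rewrite expfz_neq0 // qE. Qed.

Lemma inv6_q (k : int) : q ^ k \in inv6.
Proof.
have q6 : q \in inv6 by apply/inv6P; exists 1%N; rewrite qE.
have q6' : q^-1 \in inv6 by apply/inv6P; exists 1%N; rewrite qE.
by case: k => n; rewrite ?NegzE -?exprnP -?exprnN -?exprVn rpredX.
Qed.

(** [affine_val g = (v, k)] stands for x |-> q^k x + v. *)
Record affine_map :=
  AffineMap { affine_val : (rat * int)%type; _ : affine_val.1 \in inv6 }.

HB.instance Definition _ := [isSub for affine_val].
HB.instance Definition _ := [Choice of affine_map by <:].

Definition slope (g : affine_map) : int := (val g).2.
Definition shift (g : affine_map) : rat := (val g).1.

Lemma shiftP (g : affine_map) : shift g \in inv6. Proof. by case: g. Qed.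

Lemma affine_eq (g h : affine_map) : shift g = shift h -> slope g = slope h -> g = h.
Proof.
case: g h => [[v k] ?] [[w l] ?]; rewrite /shift /slope /= => vw kl.
by apply: val_inj; rewrite /= vw kl.
Qed.

Lemma affine1_subproof : (0 : rat, 0 : int).1 \in inv6. Proof. exact: rpred0. Qed.
Lemma affineM_subproof (g h : affine_map) :
  (shift g + q ^ slope g * shift h, slope g + slope h).1 \in inv6.
Proof. by rewrite rpredD ?rpredM ?shiftP ?inv6_q. Qed.
Lemma affineV_subproof (g : affine_map) :
  (- (q ^ (- slope g) * shift g), - slope g).1 \in inv6.
Proof. by rewrite rpredN rpredM ?shiftP ?inv6_q. Qed.

Definition affine_one := AffineMap affine1_subproof.
Definition affine_mul g h := AffineMap (affineM_subproof g h).
Definition affine_inv g := AffineMap (affineV_subproof g).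

Lemma qD (k l : int) : q ^ (k + l) = q ^ k * q ^ l.
Proof. by apply: expfzDr; rewrite qE. Qed.

Lemma affine_mulA : associative affine_mul.
Proof.
move=> g h k; apply: affine_eq; rewrite /shift /slope /= ?addrA //.
by rewrite mulrDr addrA qD mulrA.
Qed.
Lemma affine_mul1 : left_id affine_one affine_mul.
Proof. by move=> g; apply: affine_eq; rewrite /= /shift /slope /= ?add0r // mul1r. Qed.
Lemma affine_mulr1 : right_id affine_one affine_mul.
Proof. by move=> g; apply: affine_eq; rewrite /= /shift /slope /= ?mulr0 ?addr0. Qed.
Lemma affine_mulV : left_inverse affine_one affine_inv affine_mul.
Proof.
by move=> g; apply: affine_eq; rewrite /= /shift /slope /= addNr.
Qed.
Lemma affine_mulrV : right_inverse affine_one affine_inv affine_mul.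
Proof.
move=> g; apply: affine_eq; rewrite /= /shift /slope /= ?addrN //.
by rewrite mulrN mulrA -qD subrr expr0z mul1r subrr.
Qed.

HB.instance Definition _ := isGroup.Build affine_map
  affine_mulA affine_mul1 affine_mulr1 affine_mulV affine_mulrV.

(** A constant of type [groupType], so that modules over it are stated without
    structure inference on the carrier. *)
Definition aff : groupType := affine_map.

Lemma aff_eq (g h : aff) : shift g = shift h -> slope g = slope h -> g = h.
Proof. exact: affine_eq. Qed.

Lemma shift1 : shift (1%g : aff) = 0. Proof. by []. Qed.
Lemma slope1 : slope (1%g : aff) = 0. Proof. by []. Qed.
Lemma shiftM (g h : aff) : shift (g * h)%g = shift g + q ^ slope g * shift h.
Proof. by []. Qed.
Lemma slopeM (g h : aff) : slope (g * h)%g = slope g + slope h. Proof. by []. Qed.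
Lemma shiftV (g : aff) : shift g^-1%g = - (q ^ (- slope g) * shift g). Proof. by []. Qed.
Lemma slopeV (g : aff) : slope g^-1%g = - slope g. Proof. by []. Qed.

Definition affE := (shiftM, slopeM, shiftV, slopeV).

Lemma transl_subproof (x : rat) : (if x \in inv6 then x else 0, 0 : int).1 \in inv6.
Proof. by rewrite /=; case: ifP => // _; apply: rpred0. Qed.

(** Being the identity for [x] outside Z[1/6] makes this a function of [x] alone,
    free of membership proofs. *)
HB.lock Definition transl x : aff := AffineMap (transl_subproof x).
Lemma slope_transl x : slope (transl x) = 0. Proof. by rewrite unlock. Qed.
Lemma shift_transl x : x \in inv6 -> shift (transl x) = x.
Proof. by rewrite unlock /shift /= => ->. Qed.

Lemma dil_subproof (k : int) : (0 : rat, k).1 \in inv6. Proof. exact: rpred0. Qed.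
HB.lock Definition dil k : aff := AffineMap (dil_subproof k).
Lemma slope_dil k : slope (dil k) = k. Proof. by rewrite unlock. Qed.
Lemma shift_dil k : shift (dil k) = 0. Proof. by rewrite unlock. Qed.

Lemma transl0 : transl 0 = 1%g.
Proof. by apply: aff_eq; rewrite ?slope_transl ?shift_transl ?rpred0. Qed.

Lemma translD x y : x \in inv6 -> y \in inv6 -> transl (x + y) = (transl x * transl y)%g.
Proof.
move=> x6 y6; apply: aff_eq; rewrite !affE !slope_transl ?addr0 //.
by rewrite !shift_transl ?rpredD // expr0z mul1r.
Qed.

Lemma translN x : x \in inv6 -> transl (- x) = (transl x)^-1%g.
Proof.
move=> x6; apply: aff_eq; rewrite !affE !slope_transl ?oppr0 //.
by rewrite !shift_transl ?rpredN // mul1r.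
Qed.

Lemma dil_transl k x : x \in inv6 -> (dil k * transl x = transl (q ^ k * x) * dil k)%g.
Proof.
move=> x6; apply: aff_eq; rewrite !affE !slope_transl !slope_dil ?addr0 ?add0r //.
by rewrite !shift_transl ?rpredM ?inv6_q // shift_dil mulr0 addr0 add0r.
Qed.

Lemma dil0 : dil 0 = 1%g.
Proof. by apply: aff_eq; rewrite ?shift_dil ?slope_dil. Qed.

Lemma dilD k l : dil (k + l) = (dil k * dil l)%g.
Proof. by apply: aff_eq; rewrite !affE ?slope_dil ?shift_dil ?mulr0 ?addr0. Qed.

Lemma dilN k : dil (- k) = (dil k)^-1%g.
Proof. by apply: aff_eq; rewrite !affE ?slope_dil ?shift_dil ?mulr0 ?oppr0. Qed.

Lemma aff_decomp (g : aff) : g = (transl (shift g) * dil (slope g))%g.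
Proof.
apply: aff_eq; rewrite !affE ?slope_transl ?slope_dil ?add0r // shift_dil mulr0 addr0.
by rewrite shift_transl ?shiftP.
Qed.

Lemma aff_fg : finitely_generated aff.
Proof.
exists [:: transl 1; dil 1] => S grpS genS g.
have S1 : (1%g : aff) \in S by case: grpS.
have SM : {in S &, forall x y, (x * y)%g \in S} by apply: group_closedM.
have SV : {in S, forall x, (x^-1)%g \in S} by apply: group_closedV.
have Sdil k : dil k \in S.
  have SX n : dil n%:Z \in S.
    elim: n => [|n IHn]; first by rewrite dil0.
    by rewrite intS dilD SM // genS // !inE eqxx orbT.
  by case: k => n //; rewrite NegzE dilN SV.
have ST x k : x \in inv6 -> transl x \in S -> transl (q ^ k * x) \in S.
  move=> x6 Sx; rewrite -[transl _](mulgK (dil k)) -dil_transl //.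
  by rewrite !SM // SV.
have SB x y : x \in inv6 -> y \in inv6 -> transl x \in S -> transl y \in S ->
    transl (x - y) \in S.
  by move=> x6 y6 Sx Sy; rewrite translD ?rpredN // translN // SM // SV.
have S6 n : transl (6%:R ^+ n)^-1 \in S.
  elim: n => [|n IHn]; first by rewrite expr0 invr1 genS // inE eqxx.
  have x6 := inv6V n; set x := (_ ^+ n)^-1 in x6 IHn.
  have -> : (6%:R ^+ n.+1)^-1 =
      q ^ (1 : int) * x - q ^ (- 1 : int) * x - q ^ (- 1 : int) * x.
    rewrite exprS invfM -/x expr1z exprN1.
    have -> : (6%:R : rat)^-1 = q - q^-1 - q^-1 by rewrite qE.
    by rewrite !mulrBl.
  by rewrite !SB ?rpredB ?rpredM ?inv6_q ?ST.
have Sint n x : x \in inv6 -> transl x \in S -> transl (x *~ n) \in S.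
  move=> x6 Sx.
  have SX m : transl (x *+ m) \in S.
    elim: m => [|m IHm]; first by rewrite mulr0n transl0.
    by rewrite mulrS translD ?rpredMn // SM.
  case: n => m; first exact: SX.
  by rewrite NegzE mulrNz translN ?rpredMn // SV // SX.
rewrite [g]aff_decomp SM //; have /inv6P[n /intrP[m xm]] := shiftP g.
rewrite -[shift g](mulfK (_ : 6%:R ^+ n != 0)) ?expf_neq0 // xm mulrC mulrzr.
exact/Sint/S6/inv6V.
Qed.

Lemma slopeX (g : aff) n : slope (g ^+ n)%g = slope g *+ n.
Proof. by elim: n => [|n IHn] //; rewrite expgS slopeM IHn mulrS. Qed.

Lemma slope_expgz (g : aff) k : slope (expgz g k) = slope g *~ k.
Proof. by case: k => n; rewrite /expgz ?slopeV slopeX // NegzE mulrNz. Qed.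

Lemma shift_expgz (g : aff) k : slope g = 0 -> shift (expgz g k) = shift g *~ k.
Proof.
move=> g0; have shiftX n : shift (g ^+ n)%g = shift g *+ n.
  by elim: n => [|n IHn] //; rewrite expgS shiftM IHn g0 mul1r mulrS.
case: k => n; rewrite /expgz ?shiftV shiftX // slopeX g0 mul0rn oppr0 mul1r.
by rewrite NegzE mulrNz.
Qed.

Lemma aff_not_weakly_AH : ~ weakly_AH aff.
Proof.
case=> _ wAH; have one6 : 1 \in inv6 := rpred1 _.
have a1 : transl 1 <> 1%g by move=> /(congr1 shift); rewrite shift_transl.
suff /(wAH _ a1 2 3) : conjugate (expgz (transl 1) 2) (expgz (transl 1) 3) by [].
exists (dil (- 1)); rewrite /conjg -dilN opprK.
have exp2 : expgz (transl 1) 2 = transl 2%:R.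
  apply: aff_eq; rewrite ?slope_expgz ?slope_transl //.
  by rewrite shift_expgz ?slope_transl // !shift_transl ?rpred_nat.
have exp3 : expgz (transl 1) 3 = transl 3%:R.
  apply: aff_eq; rewrite ?slope_expgz ?slope_transl //.
  by rewrite shift_expgz ?slope_transl // !shift_transl ?rpred_nat.
rewrite exp2 exp3 mulgA dil_transl ?rpred_nat // dilN mulgK.
by rewrite expr1z qE divfK.
Qed.

(** * Baumslag--Solitar groups *)

Section WordAction.
Variables (X : choiceType) (R : word X -> word X -> Prop).
Variables (Y : Type) (act : X * bool -> Y -> Y).
Hypothesis actK : forall l, cancel (act l) (act (letterV l)).

Definition word_act (w : word X) (y : Y) : Y := foldl (fun y l => act l y) y w.

Lemma word_act_cat u v y : word_act (u ++ v) y = word_act v (word_act u y).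
Proof. exact: foldl_cat. Qed.

(** A right action of the free monoid on letters and inverse letters that
    satisfies the relators is an action of the presented group. *)
Lemma word_eq_act : (forall u v, R u v -> word_act u =1 word_act v) ->
  forall u v, word_eq R u v -> word_act u =1 word_act v.
Proof.
move=> actR u v.
elim=> {u v} [w|u v _ IH|u v w _ IH1 _ IH2|u u' v v' _ IH1 _ IH2|l|u v] y //.
- by rewrite IH1 IH2.
- by rewrite !word_act_cat IH1 IH2.
- by rewrite /= actK.
- exact: actR.
Qed.
End WordAction.

Section PresentedHom.
Variables (X : choiceType) (R : word X -> word X -> Prop) (G : groupType).
Variable f : {multiplicative presented R -> G}.

Definition word_val (w : word X) : G := f (pres_class R w).

Lemma word_val_cat u v : word_val (u ++ v) = (word_val u * word_val v)%g.
Proof.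
rewrite -gmulfM; congr (f _); apply/pres_classP.
by apply: word_eq_cat; apply: word_eq_sym; apply: word_eq_repr.
Qed.

Lemma word_val_nil : word_val [::] = 1%g.
Proof. by apply: (mulgI (word_val [::])); rewrite -word_val_cat mulg1. Qed.

Lemma word_valV x : word_val [:: (x, true)] = (word_val [:: (x, false)])^-1%g.
Proof.
apply: (mulgI (word_val [:: (x, false)])); rewrite mulgV -word_val_cat -word_val_nil.
by congr (f _); apply/pres_classP/(word_eq_cancel _ (x, false)).
Qed.

Lemma word_val_expz x k : word_val (word_expz x k) = expgz (word_val [:: (x, false)]) k.
Proof.
have wX b n : word_val (nseq n (x, b)) = (word_val [:: (x, b)] ^+ n)%g.
  elim: n => [|n IHn]; first exact: word_val_nil.
  by rewrite expgS -IHn -word_val_cat.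
by case: k => n; rewrite /word_expz wX // word_valV expVgn.
Qed.

Lemma word_val_eq u v : word_eq R u v -> word_val u = word_val v.
Proof. by move=> /pres_classP; rewrite /word_val => ->. Qed.

Lemma word_val_inj u v : injective f -> word_val u = word_val v -> word_eq R u v.
Proof. by move=> injf /injf /pres_classP. Qed.

End PresentedHom.

Lemma commute_expgz (G : groupType) (x y : G) k : commute x y -> commute x (expgz y k).
Proof.
by move=> cxy; case: k => n; [apply: commuteX | apply/commuteV/commuteX].
Qed.

Section Diagonal.

(** BS(m, m) acts on Z^2, its two generators by the two unit translations. *)
Definition plane_act (l : bool * bool) (y : int * int) : int * int :=
  let d := if l.2 then -1 else 1 in if l.1 then (y.1, y.2 + d) else (y.1 + d, y.2).

Lemma plane_actK l : cancel (plane_act l) (plane_act (letterV l)).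
Proof. by case: l => [[] []] [x y]; rewrite /plane_act /= ?addrK ?subrK. Qed.

Lemma plane_act_expz x k y :
  word_act plane_act (word_expz x k) y = if x then (y.1, y.2 + k) else (y.1 + k, y.2).
Proof.
have Hn b n : word_act plane_act (nseq n (x, b)) y =
   let d := if b then -1 else 1 in
   if x then (y.1, y.2 + d *+ n) else (y.1 + d *+ n, y.2).
  elim: n y => [|n IHn] [y1 y2] /=; first by rewrite !mulr0n !addr0; case: (x).
  rewrite /word_act /= -/(word_act _ _ _) IHn /plane_act /=.
  by case: (x) => /=; rewrite -addrA -mulrS.
case: k => n; rewrite /word_expz Hn /= ?natz //.
by rewrite mulNrn natz NegzE.
Qed.

Lemma BS_diag_free (m : int) (i j : int) :
  word_eq (BS_rel m m) (word_expz false i ++ word_expz true j) [::] -> i = 0 /\ j = 0.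
Proof.
have actR u v : BS_rel m m u v -> word_act plane_act u =1 word_act plane_act v.
  case=> -[x y]; rewrite 2!word_act_cat !plane_act_expz /=.
  by rewrite subrK.
move=> /(word_eq_act plane_actK actR)/(_ (0, 0)).
by rewrite word_act_cat !plane_act_expz /= !add0r => -[].
Qed.

End Diagonal.

(** Let [a] act on Z * nat as the shift of the first coordinate.  The orbits of
    [a^m] are as numerous as those of [a]: [block_div m], which divides the first
    coordinate by [m] and stores the remainder in the second one, conjugates
    [a^m] to [a].  Hence [t := block_div m; s; block_mul n] conjugates [a^m] to
    [a^n] for every permutation [s] of the second coordinate, and [s] may be
    chosen such that [a] does not commute with [t^-1 a t]. *)
Section BlockAction.
Variables m n : int.
Hypotheses (m0 : m != 0) (n0 : n != 0).

Definition block_div (m : int) (y : int * nat) : int * nat :=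
  ((y.1 %/ m)%Z, (y.2 * `|m| + `|(y.1 %% m)%Z|)%N).
Definition block_mul (m : int) (y : int * nat) : int * nat :=
  (y.1 * m + (y.2 %% `|m|)%N%:Z, (y.2 %/ `|m|)%N).

Arguments block_div : simpl never.
Arguments block_mul : simpl never.

Lemma block_divK d : d != 0 -> cancel (block_div d) (block_mul d).
Proof.
move=> d0 [z c]; have d_gt0 : (0 < `|d|)%N by rewrite absz_gt0.
have ltd : (`|(z %% d)%Z| < `|d|)%N.
  by rewrite -ltz_nat gez0_abs ?modz_ge0 // ltz_mod.
rewrite /block_mul /= modnMDl divnMDl // modn_small // divn_small // addn0.
by rewrite gez0_abs ?modz_ge0 // -divz_eq.
Qed.

Lemma block_mulK d : d != 0 -> cancel (block_mul d) (block_div d).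
Proof.
move=> d0 [z c]; have d_gt0 : (0 < `|d|)%N by rewrite absz_gt0.
have cd : (0 <= (c %% `|d|)%N%:Z < `|d|%N%:Z)%R by rewrite ltz_nat ltn_pmod.
rewrite /block_div /= divzMDl // modzMDl.
rewrite divz_small // -modz_abs modz_small // addr0.
by rewrite absz_nat -divn_eq.
Qed.

Lemma block_mul_shift d y :
  block_mul d (y.1 + 1, y.2) = ((block_mul d y).1 + d, (block_mul d y).2).
Proof. by rewrite /block_mul /= mulrDl mul1r addrAC. Qed.

Definition swap (i j c : nat) : nat := if c == i then j else if c == j then i else c.

Lemma swapL i j : swap i j i = j. Proof. by rewrite /swap eqxx. Qed.

Lemma swapN i j c : c != i -> c != j -> swap i j c = c.
Proof. by rewrite /swap => /negbTE-> /negbTE->. Qed.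

Lemma swapK i j : involutive (swap i j).
Proof.
move=> c; rewrite /swap; have [->|ci] := eqVneq c i.
  by have [->//|ji] := eqVneq j i; rewrite eqxx.
have [->|cj] := eqVneq c j; first by rewrite eqxx.
by rewrite (negbTE ci) (negbTE cj).
Qed.

Let C := `|m|%N.
Let D := (`|m| + `|n|).+1%N.
(** On the orbit of (0, 0), the last application of [block_perm] maps 1 to [C] in
    t^-1 a t a, and [C.+1] to [D] in a t^-1 a t.  As [D] exceeds [C] by more than
    [`|n|], [block_mul n] gives them different second coordinates. *)
Definition block_perm (c : nat) := swap C.+1 D (swap 1 C c).
Definition block_permV (c : nat) := swap 1 C (swap C.+1 D c).

Definition on_snd (f : nat -> nat) (y : int * nat) := (y.1, f y.2).

Lemma block_permK y : on_snd block_permV (on_snd block_perm y) = y.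
Proof. by case: y => z c; rewrite /on_snd /block_permV /block_perm !swapK. Qed.

Lemma block_permVK y : on_snd block_perm (on_snd block_permV y) = y.
Proof. by case: y => z c; rewrite /on_snd /block_permV /block_perm !swapK. Qed.

Definition block_act (l : bool * bool) (y : int * nat) : int * nat :=
  match l with
  | (false, b) => (y.1 + (if b then -1 else 1), y.2)
  | (true, false) => block_mul n (on_snd block_perm (block_div m y))
  | (true, true) => block_mul m (on_snd block_permV (block_div n y))
  end.

Lemma block_actK l : cancel (block_act l) (block_act (letterV l)).
Proof.
case: l => [[] []] y; rewrite /block_act /letterV; last 2 first.
- by rewrite /= subrK; case: y.
- by rewrite /= addrK; case: y.
- by rewrite block_mulK // block_permVK block_divK.
- by rewrite block_mulK // block_permK block_divK.
Qed.

Lemma block_act_expz k y :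
  word_act block_act (word_expz false k) y = (y.1 + k, y.2).
Proof.
have Hn b i : word_act block_act (nseq i (false, b)) y =
   (y.1 + (if b then -1 else 1) *+ i, y.2).
  elim: i y => [|i IHi] [y1 y2] /=; first by rewrite !mulr0n !addr0.
  by rewrite /word_act /= -/(word_act _ _ _) IHi /= -addrA -mulrS.
case: k => i; rewrite /word_expz Hn /= ?natz //.
by rewrite mulNrn natz NegzE.
Qed.

Lemma block_actR u v : BS_rel m n u v -> word_act block_act u =1 word_act block_act v.
Proof.
case=> y; rewrite 2!word_act_cat !block_act_expz.
set z := on_snd block_permV (block_div n y).
rewrite -[word_act _ (word_expz true (-1)) y]/(block_mul m z) -block_mul_shift.
rewrite -[LHS]/(block_mul n (on_snd block_perm (block_div m _))) block_mulK //.
rewrite -[on_snd _ _]/((on_snd block_perm z).1 + 1, (on_snd block_perm z).2).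
by rewrite block_mul_shift /z block_permVK block_divK.
Qed.

Lemma BS_gen_neq1 : ~ word_eq (BS_rel m n) [:: (false, false)] [::].
Proof. by move=> /(word_eq_act block_actK block_actR)/(_ (0, 0%N)). Qed.

Lemma BS_noncomm : (1 < `|m|)%N -> (1 < `|n|)%N ->
  ~ word_eq (BS_rel m n)
      [:: (true, true); (false, false); (true, false); (false, false)]
      [:: (false, false); (true, true); (false, false); (true, false)].
Proof.
move=> m1 n1 /(word_eq_act block_actK block_actR)/(_ (0, 0%N))/(congr1 snd).
rewrite /word_act /= /block_div /= mod0z div0z mul0n !mul0r !add0r.
have one_mod d : (1 < `|d|)%N -> (1 %% d)%Z = 1.
  by move=> d1; rewrite -modz_abs modz_small // ltz_nat.
have one_div d : (1 < `|d|)%N -> (1 %/ d)%Z = 0.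
  by move=> d1; rewrite divz_small // ltz_nat.
have perm1 : block_perm 1 = C.
  by rewrite /block_perm swapL swapN // /D /C; lia.
have permS : block_perm C.+1 = D.
  by rewrite /block_perm [swap 1 C _]swapN ?swapL // /C; lia.
have permV0 : block_permV 0 = 0%N.
  by rewrite /block_permV [swap C.+1 D _]swapN ?swapN // /C /D; lia.
have permV1 : block_permV 1 = C.
  by rewrite /block_permV [swap C.+1 D _]swapN ?swapL // /C /D; lia.
rewrite one_mod // one_div // permV0 permV1 mod0n div0n mul0n mul0r !add0r.
rewrite divnn modnn absz_gt0 m0 mul1n add0r one_mod // add0n addn1 perm1 permS.
rewrite /D -addSn divnDr ?dvdnn // divnn absz_gt0 n0 addn1 => E.
by have := leq_div2r `|n| (leqnSn C); rewrite E ltnn.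
Qed.

End BlockAction.

Lemma q_inj (k : int) : q ^ k = 1 -> k = 0.
Proof.
have q_gt0 : 0 < q by rewrite qE.
have q_neq1 : q != 1 by rewrite qE.
by move=> qk; apply: (ieexprIz q_gt0 q_neq1); rewrite qk expr0z.
Qed.

(** If [k > 0], then [3^k m = 2^k n], so 2 divides [m] and 3 divides [n]; the case
    [k < 0] is symmetric. *)
Lemma q_ratio (k m n : int) : m != 0 -> n != 0 -> k != 0 ->
  q ^ k * m%:~R = n%:~R -> (1 < `|m|)%N /\ (1 < `|n|)%N.
Proof.
have pos (i : nat) (a b : int) : a != 0 -> b != 0 ->
    q ^+ i.+1 * a%:~R = b%:~R -> (1 < `|a|)%N /\ (1 < `|b|)%N.
  move=> a0 b0; rewrite qE expr_div_n mulrAC => /(canRL (divfK _)) E.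
  have {E} : (3 ^ i.+1 * `|a|)%N = (`|b| * 2 ^ i.+1)%N.
    have /eqP : (3%:Z ^+ i.+1 * a)%:~R = (b * 2%:Z ^+ i.+1)%:~R :> rat.
      by rewrite !rmorphM !rmorphXn /= E ?expf_neq0.
    by rewrite eqr_int => /eqP/(congr1 absz); rewrite !abszM !abszX.
  move=> E; split.
    have : (2 %| `|a|)%N.
      by rewrite -(@Gauss_dvdr _ (3 ^ i.+1)) ?coprimeXr // E dvdn_mull // expnS dvdn_mulr.
    by move=> /dvdn_leq; rewrite absz_gt0; apply.
  have : (3 %| `|b|)%N.
    by rewrite -(@Gauss_dvdl _ _ (2 ^ i.+1)) ?coprimeXr // -E dvdn_mulr // expnS dvdn_mulr.
  by move=> /dvdn_leq; rewrite absz_gt0 => /(_ b0)/(leq_trans _); apply.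
move=> m0 n0; case: k => [[|i]|i] // _; first exact: pos.
rewrite NegzE => E; suff [] : (1 < `|n|)%N /\ (1 < `|m|)%N by [].
apply: (pos i) => //; rewrite -E mulrA -[q ^+ _]/(q ^ (i.+1 : int)) -qD subrr.
by rewrite expr0z mul1r.
Qed.

Lemma shift_conj (g h : aff) : slope g = 0 ->
  shift (h^-1 * g * h)%g = q ^ (- slope h) * shift g.
Proof.
move=> g0; rewrite !affE g0 addr0; set x := q ^ _; rewrite mulrC; lra.
Qed.

(** If [a] is a nontrivial translation, then [t] is a translation too, and Z[1/6]
    has rank one.
    If [a] is no translation, then [b = a^l t^-k], for [k] and [l] the slopes of
    [a] and [t], is a translation which commutes with [a^m]; as [a^m] scales the
    translations by a factor other than 1, [b] is trivial. *)
Lemma aff_rank_one (a t : aff) (m : int) : m != 0 -> commute (expgz a m) t ->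
  exists i j : int, (i, j) <> (0, 0) /\ (expgz a i * expgz t j)%g = 1%g.
Proof.
move=> m0 cat; have [a0|a0] := eqVneq (slope a) 0.
  have [p0|p0] := eqVneq (shift a) 0.
    exists 1, 0; split=> //; apply: aff_eq; rewrite !affE !slope_expgz a0 ?mul0rz //.
    by rewrite shift_expgz // p0 mul0rz add0r mul1r.
  have t0 : slope t = 0.
    apply: q_inj; have := congr1 shift cat.
    rewrite !affE slope_expgz a0 mul0rz mul1r shift_expgz // addrC => /addrI.
    have p0m : shift a *~ m != 0 by rewrite mulrz_eq0 negb_or m0.
    by move=> /esym/(canRL (mulfK p0m)) ->; rewrite divff.
  exists (numq (shift t) * denq (shift a)), (- (numq (shift a) * denq (shift t))).
  split.
    case=> _ /eqP; rewrite oppr_eq0 mulf_eq0 numq_eq0 (negbTE p0) /=.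
    by rewrite (negbTE (denq_neq0 _)).
  apply: aff_eq; rewrite !affE !slope_expgz a0 ?t0 !mul0rz // mul1r !shift_expgz //.
  have := divq_num_den (shift a); have := divq_num_den (shift t).
  have := denq_neq0 (shift a); have := denq_neq0 (shift t); rewrite -!(intr_eq0 rat).
  rewrite -[shift a *~ _]mulrzr -[shift t *~ _]mulrzr rmorphN !rmorphM shift1 /=.
  move: (numq (shift a))%:~R (denq (shift a))%:~R (numq (shift t))%:~R
    (denq (shift t))%:~R => na da nt dt dt0 da0 <- <-.
  by field; apply/andP.
exists (slope t), (- slope a); split; first by case=> _ /eqP; rewrite oppr_eq0 (negbTE a0).
set b := (_ * _)%g.
have b0 : slope b = 0.
  by rewrite /b !affE !slope_expgz mulrNz !mulrzz mulrC subrr.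
apply: aff_eq => //.
have cab : commute (expgz a m) b.
  apply: commuteM; apply: commute_expgz => //.
  by apply/commute_sym/commute_expgz.
clearbody b; have := congr1 shift cab; rewrite !affE b0 mul1r addrC => /addIr.
rewrite slope_expgz => /eqP; rewrite -subr_eq0 -[X in _ - X]mul1r -mulrBl mulf_eq0.
case/orP => /eqP // /eqP; rewrite subr_eq0 => /eqP/q_inj/eqP.
by rewrite mulrz_eq0 (negbTE a0) (negbTE m0).
Qed.

Lemma aff_BS_free : BS_free aff.
Proof.
move=> m n /eqP m0 /eqP n0 [f injf]; pose w := word_val f.
pose a := w [:: (false, false)]; pose t := w [:: (true, false)].
have wtV : w [:: (true, true)] = t^-1%g by apply: word_valV.
have rel : (t^-1 * expgz a m * t = expgz a n)%g.
  rewrite -!word_val_expz -[t]/(w (word_expz true 1)) -wtV.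
  rewrite -[w [:: (true, true)]]/(w (word_expz true (-1))).
  by rewrite -!word_val_cat -catA; apply/word_val_eq/word_eq_rel.
have aE : slope a *~ m = slope a *~ n.
  by rewrite -!slope_expgz -rel !affE addrAC addNr add0r.
have [mn|mn] := eqVneq m n.
  subst n; have [i [j [ij ijE]]] : exists i j : int,
      (i, j) <> (0, 0) /\ (expgz a i * expgz t j)%g = 1%g.
    apply: (@aff_rank_one _ _ m) => //.
    by rewrite /commute -{2}rel !mulgA mulgV mul1g.
  apply: ij; have [|-> ->//] := @BS_diag_free m i j.
  apply: (word_val_inj (f := f) injf); rewrite word_val_cat word_val_nil.
  by rewrite !word_val_expz.
have a0 : slope a = 0.
  apply/eqP; move/eqP: aE; rewrite -subr_eq0 -mulrzBr mulrz_eq0 subr_eq0.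
  by rewrite (negbTE mn).
have a1 : shift a != 0.
  apply/eqP => sa0; apply: (BS_gen_neq1 m0 n0).
  apply: (word_val_inj (f := f) injf); rewrite word_val_nil.
  exact: aff_eq.
have E : q ^ (- slope t) * m%:~R = n%:~R.
  have := congr1 shift rel; rewrite shift_conj ?slope_expgz ?a0 ?mul0rz //.
  by rewrite !shift_expgz // -[_ *~ m]mulrzr -[_ *~ n]mulrzr mulrCA => /(mulfI a1).
have t0 : - slope t != 0.
  apply: contra_neq mn => t0; apply/eqP; rewrite -(eqr_int rat) -E t0.
  by rewrite expr0z mul1r.
have [m1 n1] := q_ratio m0 n0 t0 E.
apply: (BS_noncomm m0 n0 m1 n1); apply: (word_val_inj (f := f) injf).
set u : word bool := [:: (true, true); (false, false); (true, false)].
rewrite -[X in word_val _ X = _]/(u ++ [:: (false, false)]).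
rewrite -[X in _ = word_val _ X]/([:: (false, false)] ++ u) !word_val_cat.
have -> : word_val f u = (t^-1 * a * t)%g.
  by rewrite -wtV -!word_val_cat.
have ta0 : slope (t^-1 * a * t)%g = 0 by rewrite !affE a0 addr0 addNr.
rewrite -/w -/a; move: (t^-1 * a * t)%g ta0 => b b0.
by apply: aff_eq; rewrite !affE a0 b0 // expr0z !mul1r addrC.
Qed.

(** * The three endomorphisms of the free module *)

Definition root6 (i : nat) : aff := transl (6%:R ^+ i)^-1.

Local Notation t := (dil 1).
Local Notation F := (gmod_free aff).
Local Notation c i g := (gcell i (g%g : aff)).

Lemma slope_root6X i n : slope (root6 i ^+ n)%g = 0.
Proof. by rewrite slopeX slope_transl mul0rn. Qed.

Lemma shift_root6X i n : shift (root6 i ^+ n)%g = n%:R / 6%:R ^+ i.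
Proof.
rewrite -[(_ ^+ _)%g]/(expgz _ n) shift_expgz ?slope_transl //.
by rewrite shift_transl ?inv6V // -pmulrn mulr_natl.
Qed.

Lemma root6S i : (root6 i.+1 ^+ 6)%g = root6 i.
Proof.
apply: aff_eq; rewrite ?slope_root6X ?slope_transl // shift_root6X shift_transl ?inv6V //.
by rewrite exprS invfM mulrA divff // mul1r.
Qed.

Lemma root6_dil i : (root6 i * t = t * root6 i.+1 ^+ 4)%g.
Proof.
move: (root6 i.+1 ^+ 4)%g (slope_root6X i.+1 4) (shift_root6X i.+1 4) => r r0 rE.
apply: aff_eq; rewrite !affE slope_dil ?r0 ?slope_transl // !shift_dil.
rewrite mulr0 addr0 add0r shift_transl ?inv6V // expr1z rE.
by rewrite exprS invfM !mulrA qE -[LHS]mul1r; congr (_ * _).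
Qed.

Lemma root6X_dil i j : (root6 i ^+ j * t = t * root6 i.+1 ^+ (4 * j))%g.
Proof.
elim: j => [|j IHj]; first by rewrite muln0 mul1g mulg1.
by rewrite expgSr -mulgA root6_dil (mulgA _ t) IHj mulnSr (expgnDr _ (4 * j)%N) (mulgA t).
Qed.

(** [homA], [homB] and [homC] are the moves (i, g) |-> (i, g a_i), (i+1, g) and
    (i+1, g t) minus the identity.  Since [a_i = a_{i+1}^6] and
    [a_i t = t a_{i+1}^4], passing them through [homA] replaces the last two moves
    with their multiples by a norm of [a_{i+1}], which gives [homB'] and
    [homC']. *)
HB.lock Definition homA : gmod_hom F F := free_hom (fun i => c i (root6 i) - c i 1).
HB.lock Definition homB : gmod_hom F F := free_hom (fun i => c i.+1 1 - c i 1).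
HB.lock Definition homC : gmod_hom F F := free_hom (fun i => c i.+1 t - c i 1).
HB.lock Definition homB' : gmod_hom F F :=
  free_hom (fun i => \sum_(j < 6) c i.+1 (root6 i.+1 ^+ j) - c i 1).
HB.lock Definition homC' : gmod_hom F F :=
  free_hom (fun i => \sum_(j < 4) c i.+1 (t * root6 i.+1 ^+ j) - c i 1).
HB.lock Definition aug : gmod_hom F (gmod_trivialZ aff) :=
  free_hom (M := gmod_trivialZ aff) (fun=> 1 : int).

Lemma homAE i g : homA (c i g) = c i (g * root6 i) - c i g.
Proof. by rewrite unlock free_homE raddfB !gact_gcell mulg1. Qed.
Lemma homBE i g : homB (c i g) = c i.+1 g - c i g.
Proof. by rewrite unlock free_homE raddfB !gact_gcell !mulg1. Qed.
Lemma homCE i g : homC (c i g) = c i.+1 (g * t) - c i g.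
Proof. by rewrite unlock free_homE raddfB !gact_gcell mulg1. Qed.
Lemma homB'E i g :
  homB' (c i g) = \sum_(j < 6) c i.+1 (g * root6 i.+1 ^+ j) - c i g.
Proof.
rewrite unlock free_homE raddfB raddf_sum gact_gcell mulg1; congr (_ - _).
by apply: eq_bigr => j _; rewrite gact_gcell.
Qed.
Lemma homC'E i g :
  homC' (c i g) = \sum_(j < 4) c i.+1 (g * t * root6 i.+1 ^+ j) - c i g.
Proof.
rewrite unlock free_homE raddfB raddf_sum gact_gcell mulg1; congr (_ - _).
by apply: eq_bigr => j _; rewrite gact_gcell mulgA.
Qed.
Lemma augE i g : aug (c i g) = 1 :> int.
Proof. by rewrite unlock free_homE. Qed.

Lemma homA_sum i g n :
  homA (\sum_(j < n) c i (g * root6 i ^+ j)) = c i (g * root6 i ^+ n) - c i g.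
Proof.
elim: n => [|n IHn]; first by rewrite big_ord0 raddf0 mulg1 subrr.
by rewrite big_ord_recr raddfD IHn homAE /= -mulgA -expgSr addrC subrKA.
Qed.

Lemma homBA x : homB (homA x) = homA (homB' x).
Proof.
move: x; apply: (free_ext (f := hom_comp homB homA) (h := hom_comp homA homB')) => i.
rewrite [LHS]hom_compE [RHS]hom_compE homAE homB'E (raddfB homB) (raddfB homA).
rewrite homA_sum root6S !homBE homAE !mul1g.
by rewrite !opprD !opprK addrACA.
Qed.

Lemma homCA x : homC (homA x) = homA (homC' x).
Proof.
move: x; apply: (free_ext (f := hom_comp homC homA) (h := hom_comp homA homC')) => i.
rewrite [LHS]hom_compE [RHS]hom_compE homAE homC'E (raddfB homC) (raddfB homA).
rewrite homA_sum !homCE homAE !mul1g root6_dil.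
by rewrite !opprD !opprK addrACA.
Qed.

Lemma homCB x : homC (homB x) = homB (homC x).
Proof.
move: x; apply: (free_ext (f := hom_comp homC homB) (h := hom_comp homB homC)) => i.
rewrite [LHS]hom_compE [RHS]hom_compE homBE homCE (raddfB homC) (raddfB homB).
rewrite !homBE !homCE !mul1g.
by rewrite !opprD !opprK addrACA.
Qed.

Lemma sum_block (V : zmodType) (f : nat -> V) m n :
  \sum_(j < m) \sum_(k < n) f (n * j + k)%N = \sum_(l < m * n) f l.
Proof.
elim: m => [|m IHm]; first by rewrite !big_ord0.
rewrite big_ord_recr IHm mulSnr big_split_ord; congr (_ + _).
by apply: eq_bigr => k _; rewrite /= mulnC.
Qed.

Lemma homC'B' x : homC' (homB' x) = homB' (homC' x).
Proof.
move: x; apply: (free_ext (f := hom_comp homC' homB') (h := hom_comp homB' homC')) => i.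
rewrite [LHS]hom_compE [RHS]hom_compE homB'E homC'E (raddfB homC') (raddfB homB').
rewrite !raddf_sum !homB'E !homC'E.
rewrite (eq_bigr _ (fun j _ => homC'E _ _)) [in RHS](eq_bigr _ (fun j _ => homB'E _ _)).
rewrite !sumrB !opprD !opprK !mul1g.
rewrite [LHS]addrACA; congr (_ - _ + _).
pose f l := c i.+2 (t * root6 i.+2 ^+ l).
transitivity (\sum_(j < 6) \sum_(k < 4) f (4 * j + k)%N).
  apply: eq_bigr => j _; apply: eq_bigr => k _; congr gcell.
  by rewrite mul1g root6X_dil (expgnDr _ (4 * j)%N) (mulgA t).
rewrite sum_block -[(6 * 4)%N]/(4 * 6)%N -sum_block.
apply: eq_bigr => j _; apply: eq_bigr => k _; congr gcell.
by rewrite -(root6S i.+1) -expgnA (expgnDr _ (6 * j)%N) (mulgA t).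
Qed.

Lemma homA_inj x : homA x = 0 -> x = 0.
Proof.
have homA_push : homA x = push (fun y : nat * aff => (y.1, (y.2 * root6 y.1)%g)) x - x.
  pose d := push (fun y : nat * aff => (y.1, (y.2 * root6 y.1)%g)).
  apply: (@chain_ext _ _ homA (d \- idfun)) => -[i g].
  by rewrite -[LHS]/(homA (gcell i g)) homAE -[RHS]/(d (cell _) - cell _) push_cell.
rewrite {}homA_push => /eqP; rewrite subr_eq0 => /eqP.
apply: push_fixed => -[i g] n; rewrite (_ : iter _ _ _ = (i, g * root6 i ^+ n.+1)%g).
  case=> /(canRL (mulKg g)); rewrite mulVg => /(congr1 shift)/eqP.
  by rewrite shift_root6X mulf_eq0 invr_eq0 expf_eq0 ?pnatr_eq0 andbF.
elim: n.+1 => [|m IHm]; first by rewrite mulg1.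
by rewrite iterS IHm /= -mulgA -expgSr.
Qed.

(** * Exactness *)

Definition fracpart (x : rat) : rat := x - (Num.floor x)%:~R.

Lemma fracpart_eq (x y : rat) :
  (fracpart x = fracpart y) <-> (exists n : int, x - y = n%:~R).
Proof.
split=> [E|[n E]].
  exists (Num.floor x - Num.floor y); move: E; rewrite /fracpart rmorphB /=.
  by move: (Num.floor x)%:~R (Num.floor y)%:~R => u v E; lra.
rewrite -[x](subrK y) E /fracpart floorDzr ?intr_int // intrKfloor rmorphD /=.
by ring.
Qed.

(** [coset i g] determines the coset of [g] modulo the group generated by
    [root6 i]: conjugating by [g] to the left, [root6 i] is a translation by
    [q ^ slope g / 6 ^ i], so the shift matters modulo that number only. *)
Definition coset (i : nat) (g : aff) : int * rat :=
  (slope g, fracpart (shift g * q ^ (- slope g) * 6%:R ^+ i)).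

Lemma coset_root6 i g : coset i (g * root6 i)%g = coset i g.
Proof.
rewrite /coset slopeM slope_transl addr0; congr (_, _); apply/fracpart_eq; exists 1.
rewrite shiftM shift_transl ?inv6V // !mulrDl addrAC subrr add0r.
by rewrite [X in X * _]mulrAC -qD subrr expr0z mul1r mulVf ?expf_neq0.
Qed.

Lemma coset_eq i g h : coset i g = coset i h ->
  exists n, h = (g * root6 i ^+ n)%g \/ g = (h * root6 i ^+ n)%g.
Proof.
case=> sgh /fracpart_eq[d]; rewrite -sgh -!mulrBl.
move=> /(canRL (mulfK (expf_neq0 i _)))-/(_ isT) /(canRL (mulfK (q_neq0 _))) dE.
have root n u v : slope u = slope v ->
    shift v = shift u + q ^ (slope u) * (n%:R / 6%:R ^+ i) -> v = (u * root6 i ^+ n)%g.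
  by move=> suv E; apply: aff_eq; rewrite ?shiftM ?slopeM ?slope_root6X ?shift_root6X ?addr0.
have qV : (q ^ (- slope g))^-1 = q ^ slope g.
  by apply: (mulIf (q_neq0 (- slope g))); rewrite mulVf ?q_neq0 // -qD subrr.
rewrite {}qV mulrC in dE.
case: d dE => n dE; [exists n; right | exists n.+1; left]; apply: root => //.
  by rewrite -sgh -[LHS](subrK (shift h)) dE addrC pmulrn.
by rewrite -[LHS](subKr (shift g)) dE NegzE rmorphN mulNr mulrN opprK pmulrn.
Qed.

(** A subgroup [S] of the chains containing the image of [homA] identifies points
    of the same coset; if it contains the image of [homB], points of the same
    slope, since the [root6 i] exhaust Z[1/6]; and, if it contains the image of
    [homC] too, all points. *)
Section Relations.
Variable S : F -> Prop.
Hypotheses (S0 : S 0) (SB : forall z w, S z -> S w -> S (z - w)).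
Hypothesis SA : forall z, S (homA z).

Lemma relN z w : S (z - w) -> S (w - z).
Proof. by move=> Szw; rewrite -opprB -[- _]add0r; apply: SB. Qed.

Lemma rel_trans z w v : S (z - w) -> S (w - v) -> S (z - v).
Proof.
by move=> Szw /relN Svw; have := SB Szw Svw; rewrite opprB addrA subrK.
Qed.

Lemma rel_coset i g h : coset i g = coset i h -> S (c i g - c i h).
Proof.
have root u n : S (c i (u * root6 i ^+ n) - c i u) by rewrite -homA_sum.
by case/coset_eq=> n [] ->; [apply/relN|].
Qed.

Hypothesis SBh : forall z, S (homB z).

Lemma rel_raise i n g : S (c (n + i) g - c i g).
Proof.
elim: n => [|n IHn]; first by rewrite subrr.
by apply: rel_trans IHn; rewrite -homBE.
Qed.

Lemma rel_slope i j g h : slope g = slope h -> S (c i g - c j h).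
Proof.
move=> sgh; have /inv6P[n /intrP[d dE]] : (shift g - shift h) * q ^ (- slope g) \in inv6.
  by rewrite rpredM ?rpredB ?shiftP ?inv6_q.
pose N := (n + (i + j))%N.
have raise k u : (k <= N)%N -> S (c N u - c k u).
  by move=> kN; rewrite -(subnK kN); apply: rel_raise.
apply: (rel_trans (w := c N g)).
  by apply/relN/raise; rewrite /N; lia.
apply: (rel_trans (w := c N h)); last by apply: raise; rewrite /N; lia.
apply: rel_coset; rewrite /coset -sgh; congr (_, _); apply/fracpart_eq.
exists (d * 6%:Z ^+ (i + j)); rewrite -!mulrBl /N exprD mulrA dE.
by rewrite rmorphM rmorphXn.
Qed.

Hypothesis SC : forall z, S (homC z).

Lemma rel_all i j g h : S (c i g - c j h).
Proof.
have dil_up n k u : S (c (n + k) (u * dil n%:Z) - c k u).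
  elim: n => [|n IHn]; first by apply: rel_slope; rewrite slopeM slope_dil addr0.
  by apply: rel_trans IHn; rewrite -addn1 PoszD dilD mulgA addn1 addSn -homCE.
wlog le : i j g h / slope g <= slope h.
  move=> wl; have [/wl//|/ltW/wl-hg] := leP (slope g) (slope h).
  exact/relN/hg.
apply: rel_trans (relN (dil_up `|slope h - slope g|%N i g)) _.
by apply: rel_slope; rewrite slopeM slope_dil gez0_abs ?subr_ge0 // addrCA subrr addr0.
Qed.

End Relations.

Lemma iter_fst (T : Type) (f : nat * T -> nat * T) n y :
  (forall y, (f y).1 = y.1.+1) -> (iter n f y).1 = (n + y.1)%N.
Proof. by move=> fS; elim: n => //= n IHn; rewrite fS IHn. Qed.

(** In the set of cosets, the second move raises the index [i], so it has no
    periodic point. *)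
Lemma homB_regular x y : homB x = homA y -> exists y', x = homA y'.
Proof.
pose p (z : nat * aff) := (z.1, coset z.1 z.2).
pose phi (z : nat * (int * rat)) := (z.1.+1, (z.2.1, fracpart (6%:R * z.2.2))).
have pA z : push p (homA z) = 0.
  move: z; apply: (additive_ext (f := push p \o homA) (h := \0)) => i g.
  rewrite -[LHS]/(push p (homA (c i g))) homAE (raddfB (push p)) !push_gcell.
  by rewrite /p /= coset_root6 subrr.
have pB z : push p (homB z) = push phi (push p z) - push p z.
  move: z; apply: (additive_ext (f := push p \o homB)
    (h := push phi \o push p \- push p)) => i g.
  rewrite -[LHS]/(push p (homB (c i g))) homBE (raddfB (push p)).
  rewrite -[RHS]/(push phi (push p (c i g)) - push p (c i g)).
  rewrite !push_gcell push_cell; congr (cell (_, (_, _)) - _).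
  apply/fracpart_eq; rewrite exprSr mulrA /=; set u := _ * 6%:R ^+ i.
  exists (6 * Num.floor u); rewrite mulrC /fracpart mulrBr opprB addrC subrK.
  by rewrite rmorphM.
move=> /(congr1 (push p)); rewrite pA pB => /eqP; rewrite subr_eq0 => /eqP.
move=> /push_fixed px0.
have {px0} : push p x = 0.
  apply: px0 => z n /(congr1 fst); rewrite iter_fst // => /eqP.
  by rewrite -{2}[z.1]add0n eqn_add2r.
pose S (z : F) := exists y', z = homA y'.
have S0 : S 0 by exists 0; rewrite raddf0.
have SB z w : S z -> S w -> S (z - w).
  by move=> [u ->] [v ->]; exists (u - v); rewrite raddfB.
have SA z : S (homA z) by exists z.
apply: (ker_push (S := S)) => // -[i g] [j h] E.
have ij : i = j := congr1 fst E; subst j.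
exact: (@rel_coset S S0 SB SA i g h (congr1 snd E)).
Qed.

Lemma push_slopeA z : push (fun y : nat * aff => slope y.2) (homA z) = 0.
Proof.
pose p (y : nat * aff) := slope y.2.
move: z; apply: (additive_ext (f := push p \o homA) (h := \0)) => i g.
rewrite -[LHS]/(push p (homA (c i g))) homAE (raddfB (push p)) !push_gcell.
by rewrite /p /= slopeM slope_transl addr0 subrr.
Qed.

Lemma push_slopeB z : push (fun y : nat * aff => slope y.2) (homB z) = 0.
Proof.
pose p (y : nat * aff) := slope y.2.
move: z; apply: (additive_ext (f := push p \o homB) (h := \0)) => i g.
rewrite -[LHS]/(push p (homB (c i g))) homBE (raddfB (push p)) !push_gcell.
by rewrite subrr.
Qed.

(** In the set of slopes, the third move is the translation by 1. *)
Lemma homC_regular x y z : homC x = homA y + homB z ->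
  exists y' z', x = homA y' + homB z'.
Proof.
pose p (y : nat * aff) := slope y.2; pose phi (k : int) := k + 1.
have pC w : push p (homC w) = push phi (push p w) - push p w.
  move: w; apply: (additive_ext (f := push p \o homC)
    (h := push phi \o push p \- push p)) => i g.
  rewrite -[LHS]/(push p (homC (c i g))) homCE (raddfB (push p)).
  rewrite -[RHS]/(push phi (push p (c i g)) - push p (c i g)).
  by rewrite !push_gcell push_cell /p /phi /= slopeM slope_dil.
move=> /(congr1 (push p)); rewrite pC (raddfD (push p)) push_slopeA push_slopeB addr0.
move=> /eqP; rewrite subr_eq0 => /eqP/push_fixed px0.
have {px0} : push p x = 0.
  apply: px0 => k n; have -> : iter n.+1 phi k = k + n.+1%:Z.
    by elim: n.+1 => [|m IHm]; rewrite ?addr0 // iterS IHm /phi; lia.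
  by lia.
pose S (x : F) := exists y z, x = homA y + homB z.
have S0 : S 0 by exists 0, 0; rewrite !raddf0 addr0.
have SB v w : S v -> S w -> S (v - w).
  move=> [u [u' ->]] [v1 [v1' ->]]; exists (u - v1), (u' - v1').
  by rewrite (raddfB homA) (raddfB homB) opprD addrACA.
have SA v : S (homA v) by exists v, 0; rewrite raddf0 addr0.
have SBh v : S (homB v) by exists 0, v; rewrite raddf0 add0r.
apply: (ker_push (S := S)) => // -[i g] [j h] gh.
exact: (@rel_slope S S0 SB SA SBh i j g h gh).
Qed.

Lemma augP x : aug x = 0 <-> exists u v w, x = homA u + homB v + homC w.
Proof.
split=> [x0|[u [v [w ->]]]]; last first.
  have augA z : aug (homA z) = 0.
    move: z; apply: (additive_ext (f := aug \o homA) (h := \0)) => i g.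
    by rewrite -[LHS]/(aug (homA (c i g))) homAE (raddfB aug) !augE subrr.
  have augB z : aug (homB z) = 0.
    move: z; apply: (additive_ext (f := aug \o homB) (h := \0)) => i g.
    by rewrite -[LHS]/(aug (homB (c i g))) homBE (raddfB aug) !augE subrr.
  have augC z : aug (homC z) = 0.
    move: z; apply: (additive_ext (f := aug \o homC) (h := \0)) => i g.
    by rewrite -[LHS]/(aug (homC (c i g))) homCE (raddfB aug) !augE subrr.
  by rewrite !(raddfD aug) augA augB augC !addr0.
pose p (_ : nat * aff) := tt.
have pE z : push p z = cell tt *~ (aug z : int).
  move: z; apply: chain_ind => [|z w zE wE|[i g]].
  - by rewrite !raddf0.
  - by rewrite (raddfB (push p)) (raddfB aug) zE wE mulrzBr.
  - by rewrite -[cell _]/(c i g) augE push_gcell.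
have px0 : push p x = 0 by rewrite pE x0.
pose S (x : F) := exists u v w, x = homA u + homB v + homC w.
have S0 : S 0 by exists 0, 0, 0; rewrite !raddf0 !addr0.
have SB v w : S v -> S w -> S (v - w).
  move=> [a [b [d ->]]] [a' [b' [d' ->]]]; exists (a - a'), (b - b'), (d - d').
  rewrite (raddfB homA) (raddfB homB) (raddfB homC) !opprD.
  by rewrite [LHS]addrACA [X in X + _ = _]addrACA.
have SA v : S (homA v) by exists v, 0, 0; rewrite !raddf0 !addr0.
have SBh v : S (homB v) by exists 0, v, 0; rewrite !raddf0 addr0 add0r.
have SC v : S (homC v) by exists 0, 0, v; rewrite !raddf0 !add0r.
apply: (ker_push (S := S)) px0 => // -[i g] [j h] _.
exact: (@rel_all S S0 SB SA SBh SC i j g h).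
Qed.

Lemma aug_surj : surjective aug.
Proof.
move=> k; exists (c 0 1 *~ k).
by rewrite (raddfMz aug) augE -mulrzr mul1r intz.
Qed.

Lemma aff_cd_le3 : cd_le aff 3.
Proof.
exact: (koszul_cd_le (@projective_free aff) homBA homCA homCB homC'B' homA_inj
  homB_regular homC_regular aug_surj augP).
Qed.

(** * Integrality at a prime *)

(** Membership in the localization of Z at [p], for rational numbers. *)
Definition pint (p : nat) (x : rat) : bool :=
  `[< exists2 b : nat, coprime p b & x * b%:R \is a Num.int >].

Lemma pintP p x :
  reflect (exists2 b : nat, coprime p b & x * b%:R \is a Num.int) (pint p x).
Proof. exact: asboolP. Qed.

Lemma pint_int p x : x \is a Num.int -> pint p x.
Proof. by move=> xZ; apply/pintP; exists 1%N; rewrite ?coprimen1 ?mulr1. Qed.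

Lemma pintB p x y : pint p x -> pint p y -> pint p (x - y).
Proof.
move=> /pintP[b pb xb] /pintP[b' pb' yb']; apply/pintP.
exists (b * b')%N; first by rewrite coprimeMr pb.
rewrite natrM mulrBl mulrA [y * _]mulrCA rpredB // rpredM // ?rpred_nat //.
Qed.

Lemma pint_subr p x y : pint p y -> pint p (x - y) = pint p x.
Proof.
move=> py; apply/idP/idP => [pxy|/pintB]; last exact.
rewrite -[x](subrK y) -[y in _ + y]opprK; apply: pintB => //.
by rewrite -sub0r; apply: pintB => //; apply: pint_int; apply: rpred0.
Qed.

Lemma pint_addr p x y : pint p y -> pint p (x + y) = pint p x.
Proof. by move=> py; rewrite -[in RHS](addrK y x) pint_subr. Qed.

Lemma pint_div p x (d : nat) : (0 < d)%N -> coprime p d -> pint p (x / d%:R) = pint p x.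
Proof.
move=> d0 pd; have dN0 : d%:R != 0 :> rat by rewrite pnatr_eq0 -lt0n.
apply/pintP/pintP => -[b pb xb].
  by exists b => //; rewrite -[x](divfK dN0) mulrAC rpredM ?rpred_nat.
by exists (b * d)%N; rewrite ?coprimeMr ?pb // natrM [b%:R * _]mulrC mulrA divfK.
Qed.

(** For [N] a power of [p], exactly one of the [N] translates of a [p]-integral
    number by [0, ..., N - 1] is divisible by [N] in the local ring. *)
Lemma pint_residue p N x : (0 < N)%N -> (forall b, coprime p b -> coprime N b) ->
  exists2 r, (r < N)%N & forall j : nat,
    pint p ((x + j%:R) / N%:R) = pint p x && (j == r %[mod N])%N.
Proof.
move=> N0 pN; have NN0 : N%:R != 0 :> rat by rewrite pnatr_eq0 -lt0n.
have [px|px] := boolP (pint p x); last first.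
  exists 0%N => // j; apply: contraNF px => pxj.
  have /pintP[b pb xb] := pxj; apply/pintP; exists b => //.
  rewrite -[x](addrK j%:R) mulrBl; apply: rpredB; last by rewrite rpredM ?rpred_nat.
  by rewrite -[x + _](divfK NN0) mulrAC rpredM ?rpred_nat.
have /pintP[b pb /intrP[a aE]] := px.
have /(coprimeP _ N0)[[u v] /= uv] : coprime N b by apply: pN.
have uvZ : u%:Z * N%:Z = 1 + v%:Z * b%:Z by lia.
pose m := (a * v%:Z %/ N%:Z)%Z; pose r := `|(a * v%:Z %% N%:Z)%Z|%N.
have rE : r%:Z = (a * v%:Z %% N%:Z)%Z by rewrite gez0_abs // modz_ge0 // -lt0n.
have ltrN : (r < N)%N by rewrite -ltz_nat rE ltz_pmod.
have pxr : pint p ((x + r%:R) / N%:R).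
  apply/pintP; exists b => //; apply/intrP; exists (a * u%:Z - m * b%:Z).
  have E : a + r%:Z * b%:Z = (a * u%:Z - m * b%:Z) * N%:Z.
    have avE : a * v%:Z = m * N%:Z + r%:Z by rewrite rE -divz_eq.
    have -> : r%:Z = a * v%:Z - m * N%:Z by rewrite avE addrC addKr.
    by rewrite !mulrBl -[a * u%:Z * _]mulrA uvZ; ring.
  rewrite mulrAC; apply: (canLR (mulfK NN0)).
  have intrN (k : nat) : k%:R = (k%:Z)%:~R :> rat by [].
  by rewrite mulrDl aE !intrN -!intrM -intrD E.
exists r => // j.
have -> : (x + j%:R) / N%:R = (x + r%:R) / N%:R + (j%:R - r%:R) / N%:R.
  by rewrite -mulrDl addrACA subrr addr0.
rewrite addrC pint_addr //=; apply/idP/idP.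
  case/pintP => d pd /intrP[k kE].
  have {}kE : (j%:Z - r%:Z) * d%:Z = k * N%:Z.
    apply/eqP; rewrite -(eqr_int rat) !intrM intrB; apply/eqP.
    by apply: (canRL (divfK NN0)); rewrite -kE mulrAC.
  have : (N%:Z %| j%:Z - r%:Z)%Z.
    by rewrite -(@Gauss_dvdzl _ _ d) ?kE ?dvdz_mull // coprimezE !absz_nat pN.
  by rewrite -eqz_mod_dvd !modz_nat eqz_nat.
rewrite -eqz_nat -!modz_nat eqz_mod_dvd => /dvdzP[k kE]; apply/pint_int/intrP; exists k.
have -> : j%:R - r%:R = (k * N%:Z)%:~R :> rat by rewrite -kE intrB.
by rewrite intrM mulfK.
Qed.

(** * The functionals *)

Definition ind (p : nat) (x : rat) : int := (pint p x : nat)%:Z.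

(** By the Chinese remainder theorem, one translate out of six is divisible by 2
    in the first place and by 3 in the second one. *)
Lemma sum_ind6 x y :
  \sum_(j < 6) ind 2 ((x + j%:R) / 6%:R) * ind 3 ((y + j%:R) / 6%:R) =
  ind 2 x * ind 3 y.
Proof.
have [//|//|r ltr rE] := @pint_residue 2 2 x.
have [//|//|s lts sE] := @pint_residue 3 3 y.
have E2 j : pint 2 ((x + j%:R) / 6%:R) = pint 2 x && (j == r %[mod 2])%N.
  by rewrite -rE -[6%:R]/((2 * 3)%N%:R) natrM invfM mulrA (@pint_div _ _ 3).
have E3 j : pint 3 ((y + j%:R) / 6%:R) = pint 3 y && (j == s %[mod 3])%N.
  by rewrite -sE -[6%:R]/((3 * 2)%N%:R) natrM invfM mulrA (@pint_div _ _ 2).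
rewrite /ind; under eq_bigr do rewrite E2 E3.
move: r s ltr lts {rE sE E2 E3} => [|[|//]] [|[|[|//]]] _ _;
  by case: (pint 2 x); case: (pint 3 y); rewrite !big_ord_recr big_ord0.
Qed.

(** At 3, the division by 4 and the translations are immaterial. *)
Lemma sum_ind4 x y :
  \sum_(j < 4) ind 2 ((x + j%:R) / 4%:R) * ind 3 ((y + j%:R) / 4%:R) =
  ind 2 x * ind 3 y.
Proof.
have [//|b|r ltr rE] := @pint_residue 2 4 x; first exact: (coprimeXl 2).
have E3 j : pint 3 ((y + j%:R) / 4%:R) = pint 3 y.
  by rewrite pint_div // pint_addr // pint_int // rpred_nat.
rewrite /ind; under eq_bigr do rewrite rE E3.
move: r ltr {rE} => [|[|[|[|//]]]] _;
  by case: (pint 2 x); case: (pint 3 y); rewrite !big_ord_recr big_ord0.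
Qed.

Section Functional.
Variable J : nat.

(** The measure (delta_0 - delta_u) x (delta_0 - delta_v), moved by [q ^ slope g]
    and evaluated on the ball shift g + 6^-i (Z_2 x Z_3), where Z_p stands for the
    p-adic integers. *)
Definition weight (i : nat) (g : aff) : int :=
  let x := 6%:R ^+ i * shift g in
  let y := 6%:R ^+ i * (q ^ slope g / 2%:R ^+ J.+1) in
  let z := 6%:R ^+ i * (q ^ slope g / 3%:R ^+ J.+1) in
  (ind 2 x - ind 2 (x - y)) * (ind 3 x - ind 3 (x - z)).

Lemma ind_add1 p x : ind p (x + 1) = ind p x.
Proof. by rewrite /ind pint_addr // pint_int // rpred1. Qed.

Lemma weight_root6 i g : weight i (root6 i * g)%g = weight i g.
Proof.
have vE : 6%:R ^+ i * shift (root6 i * g)%g = 6%:R ^+ i * shift g + 1.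
  rewrite shiftM slope_transl expr0z mul1r shift_transl ?inv6V //.
  by rewrite mulrDr divff ?expf_neq0 // addrC.
rewrite /weight slopeM slope_transl add0r vE.
by rewrite ![_ * shift g + 1 - _]addrAC !ind_add1.
Qed.

Lemma sum_diff_prod m (f h : nat -> rat -> rat) :
    (forall x y, \sum_(j < m) ind 2 (f j x) * ind 3 (f j y) = ind 2 x * ind 3 y) ->
  forall x x' y y',
    \sum_(j < m) (ind 2 (f j x) - ind 2 (f j x')) * (ind 3 (f j y) - ind 3 (f j y')) =
    (ind 2 x - ind 2 x') * (ind 3 y - ind 3 y').
Proof.
move=> fP x x' y y'; under eq_bigr do rewrite mulrBl !mulrBr.
by rewrite !sumrB !fP -mulrBr -mulrBr -mulrBl.
Qed.

(** A ball at level [i.+1] is a disjoint union of six balls at level [i]. *)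
Lemma weight_sum6 i g : \sum_(j < 6) weight i (root6 i.+1 ^+ j * g)%g = weight i.+1 g.
Proof.
pose f (j : nat) (x : rat) := (x + j%:R) / 6%:R.
rewrite -[RHS](@sum_diff_prod 6 f f sum_ind6); apply: eq_bigr => j _.
have divE z : (6%:R ^+ i.+1 * z + j%:R) / 6%:R = 6%:R ^+ i * (z + j%:R / 6%:R ^+ i.+1) :> rat.
  by rewrite exprS; field; rewrite expf_neq0.
rewrite /weight slopeM slope_root6X add0r shiftM slope_root6X expr0z mul1r shift_root6X.
by rewrite /f -!mulrBr !divE ![_ - _ + j%:R / _]addrAC ![shift g + _]addrC.
Qed.

(** Multiplication by 3/2 turns the ball of [g] at level [i.+1] into a translate of
    6^-i / 4 (Z_2 x Z_3), which is a disjoint union of four balls at level [i]; it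
    also turns the measure moved by [q ^ slope g] into the next one. *)
Lemma weight_sum4 i g :
  \sum_(j < 4) weight i (t * root6 i.+1 ^+ j * g)%g = weight i.+1 g.
Proof.
pose f (j : nat) (x : rat) := (x + j%:R) / 4%:R.
rewrite -[RHS](@sum_diff_prod 4 f f sum_ind4); apply: eq_bigr => j _.
have divE z : (6%:R ^+ i.+1 * z + j%:R) / 4%:R =
    6%:R ^+ i * (q * (z + j%:R / 6%:R ^+ i.+1)) :> rat.
  by rewrite qE exprS; field; rewrite expf_neq0.
have vE : shift (t * root6 i.+1 ^+ j * g)%g = q * (shift g + j%:R / 6%:R ^+ i.+1).
  rewrite -mulgA shiftM shift_dil slope_dil add0r expr1z shiftM slope_root6X.
  by rewrite expr0z mul1r shift_root6X addrC.
rewrite /weight vE !slopeM slope_dil slope_root6X addr0 qD expr1z.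
by rewrite /f -!mulrBr !divE -![q * _ / _]mulrA -!mulrBr ![_ - _ + j%:R / _]addrAC.
Qed.

(** At this level, a ball does not separate the two points at the prime 2 if the
    slope is nonpositive, nor those at the prime 3 if it is nonnegative. *)
Lemma weight_last g : weight J.+1 g = 0.
Proof.
rewrite /weight; set x := _ * shift g; set y := _ * (_ / 2%:R ^+ _).
set z := _ * (_ / 3%:R ^+ _).
have ind_same p u v : pint p v -> ind p u - ind p (u - v) = 0.
  by move=> pv; rewrite /ind pint_subr // subrr.
have yE : y = 3%:R ^+ J.+1 * q ^ slope g.
  rewrite /y -[6%:R]/((3 * 2)%N%:R) natrM exprMn.
  by field; rewrite expf_neq0.
have zE : z = 2%:R ^+ J.+1 * q ^ slope g.
  rewrite /z -[6%:R]/((3 * 2)%N%:R) natrM exprMn.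
  by field; rewrite expf_neq0.
case: (slope g) yE zE => n yE zE.
  rewrite [X in _ * X]ind_same ?mulr0 // zE qE -[_ ^ _]/(_ ^+ n) expr_div_n.
  rewrite mulrA -!natrX pint_div ?expn_gt0 ?coprimeXr // -natrM.
  by rewrite pint_int // rpred_nat.
rewrite [X in X * _]ind_same ?mul0r // yE qE NegzE -exprnN -exprVn invf_div expr_div_n.
rewrite mulrA -!natrX pint_div ?expn_gt0 ?coprimeXr // -natrM.
by rewrite pint_int // rpred_nat.
Qed.

Lemma weight_one : weight J 1%g = 1.
Proof.
have pint0 p : pint p 0 by apply: pint_int; apply: rpred0.
have pintN p x : pint p (0 - x) = pint p x.
  by apply/idP/idP => /(pintB (pint0 p)); rewrite ?sub0r ?opprK.
have half (p d : nat) : prime p -> ~~ (p %| d)%N -> pint p (d%:R / p%:R) = false.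
  move=> p_pr pd; have p0 : p%:R != 0 :> rat by rewrite pnatr_eq0 -lt0n prime_gt0.
  apply/negP => /pintP[b pb /intrP[k kE]]; case/negP: pd.
  rewrite -(Gauss_dvdl d pb) -[X in (X %| _)%N](absz_nat p).
  rewrite -[X in (_ %| X)%N]absz_nat -dvdzE.
  apply/dvdzP; exists k.
  apply/eqP; rewrite -(eqr_int rat) [X in _ == X]intrM -kE mulrAC divfK // -natrM.
  by [].
rewrite /weight shift1 slope1 mulr0 expr0z /ind !pintN !pint0.
have -> : 6%:R ^+ J * (1 / 2%:R ^+ J.+1) = (3 ^ J)%N%:R / 2%:R :> rat.
  rewrite -[6%:R]/((3 * 2)%N%:R) natrM exprMn natrX exprS.
  by field; rewrite expf_neq0.
have -> : 6%:R ^+ J * (1 / 3%:R ^+ J.+1) = (2 ^ J)%N%:R / 3%:R :> rat.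
  rewrite -[6%:R]/((3 * 2)%N%:R) natrM exprMn natrX exprS.
  by field; rewrite expf_neq0.
by rewrite !half // Euclid_dvdX.
Qed.

Definition functional (i : nat) : {additive F -> int} :=
  chain_lift (fun y : nat * aff => if y.1 == J then weight i y.2 else 0).

Lemma functionalE i j g : functional i (c j g) = if j == J then weight i g else 0.
Proof. exact: lift_gcell. Qed.

Lemma functional_root6 i z : functional i (gact (root6 i) z) = functional i z.
Proof.
move: z; apply: (additive_ext (f := functional i \o gact (root6 i))
  (h := functional i)) => j g.
rewrite -[LHS]/(functional i (gact (root6 i) (c j g))) gact_gcell !functionalE.
by case: eqP => // _; rewrite weight_root6.
Qed.

Definition sum_act m (s : nat -> aff) (z : F) : F := \sum_(j < m) gact (s j) z.

Lemma sum_actB m s : {morph sum_act m s : z w / z - w}.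
Proof. by move=> z w; rewrite /sum_act -sumrB; apply: eq_bigr => j _; rewrite raddfB. Qed.

Lemma functional_sum i m (s : nat -> aff) :
    (forall g, \sum_(j < m) weight i (s j * g)%g = weight i.+1 g) ->
  forall z, functional i (\sum_(j < m) gact (s j) z) = functional i.+1 z.
Proof.
move=> sP z; pose s' := additive_of (@sum_actB m s).
suff E : functional i \o s' =1 functional i.+1 by apply: E.
apply: (additive_ext (f := functional i \o s') (h := functional i.+1)) => j g.
rewrite -[LHS]/(functional i (\sum_(k < m) gact (s k) (c j g))).
under eq_bigr do rewrite gact_gcell.
rewrite raddf_sum functionalE; under eq_bigr do rewrite functionalE.
by case: eqP => _; [apply: sP | rewrite big1].
Qed.

Lemma functional_last z : functional J.+1 z = 0.
Proof.
move: z; apply: (additive_ext (f := functional J.+1) (h := \0)) => j g.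
by rewrite functionalE weight_last if_same.
Qed.

End Functional.

Lemma functional_vanish (z : F) : exists N, forall J i, (N <= J)%N -> functional J i z = 0.
Proof.
move: z; apply: chain_ind => [|z w [N zN] [M wM]|[j g]].
- by exists 0%N => J i _; rewrite raddf0.
- exists (N + M)%N => J i le; rewrite (raddfB (functional J i)) zN ?wM ?subrr //; lia.
- by exists j.+1 => J i le; rewrite -[cell _]/(c j g) functionalE ifN // neq_ltn le.
Qed.

(** [D i] is [L_i (x_i - y_i)] in the notation of the introduction. *)
Lemma aff_cd_ge3 m : cd_le aff m -> (3 <= m)%N.
Proof.
move=> cdm; rewrite leqNgt; apply/negP => ltm3.
have [r1 [r2 [r3 rP]]] := koszul_retraction (@projective_free aff) homBA homCA homCB
  homC'B' homA_inj homB_regular homC_regular aug_surj augP cdm ltm3.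
pose x i := r1 (c i 1); pose y i := r2 (c i 1).
have [N NP] := functional_vanish (x 0%N - y 0%N).
pose L := functional N; pose D i := L i (x i) - L i (y i).
have step i : D i.+1 - D i = if i == N then 1 else 0.
  have <- : L i (c i 1) = if i == N then 1 else 0.
    by rewrite functionalE; case: eqP => // ->; rewrite weight_one.
  have cA g : c i.+1 g = gact g (c i.+1 1) by rewrite gact_gcell mulg1.
  have r1E : L i (r1 (homC' (c i 1))) = L i.+1 (x i.+1) - L i (x i).
    rewrite homC'E (raddfB r1) (raddfB (L i)) raddf_sum.
    under eq_bigr => j _ do rewrite mul1g cA gmod_funJ.
    by rewrite [L i (\sum_(_ < _) _)](functional_sum
      (s := fun j => (t * root6 i.+1 ^+ j)%g) (weight_sum4 N i)).
  have r2E : L i (r2 (homB' (c i 1))) = L i.+1 (y i.+1) - L i (y i).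
    rewrite homB'E (raddfB r2) (raddfB (L i)) raddf_sum.
    under eq_bigr => j _ do rewrite mul1g cA gmod_funJ.
    by rewrite [L i (\sum_(_ < _) _)](functional_sum
      (s := fun j => (root6 i.+1 ^+ j)%g) (weight_sum6 N i)).
  have r3E : L i (r3 (homA (c i 1))) = 0.
    have aE : c i (root6 i) = gact (root6 i) (c i 1) by rewrite gact_gcell mulg1.
    by rewrite homAE mul1g aE (raddfB r3) gmod_funJ (raddfB (L i)) functional_root6 subrr.
  rewrite -[in RHS](rP (c i 1)) (raddfD (L i)) (raddfB (L i)) r1E r2E r3E addr0 /D.
  by rewrite !opprD !opprK addrACA.
have D0 i : (i <= N)%N -> D i = 0.
  elim: i => [_|i IHi lt]; first by rewrite /D -(raddfB (L 0%N)) NP.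
  by have := step i; rewrite IHi 1?ltnW // subr0 ltn_eqF.
have DN : D N.+1 = 0 by rewrite /D /L !functional_last subrr.
by have := step N; rewrite DN (D0 N (leqnn N)) eqxx.
Qed.

Lemma aff_cd : cohomological_dimension aff 3.
Proof. by split; [apply: aff_cd_le3 | apply: aff_cd_ge3]. Qed.

Theorem theorem6p10 :
  exists G : groupType,
    [/\ finitely_generated G,
        BS_free G,
        cohomological_dimension G 3
      & ~ weakly_AH G].
Proof.
exists aff; split.
- exact: aff_fg.
- exact: aff_BS_free.
- exact: aff_cd.
- exact: aff_not_weakly_AH.
Qed.
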